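(* $\textsc{Nephew}\in\mathsf{TFZPP}\cap\mathsf{PWPP}$.
   Context: $\textsc{Nephew}$: the input is a set $V=\{0,1\}^n$ and two functions $f,g:V\to V$ given as Boolean circuits; a solution is any $u\in V$ such that $f(f(g(u)))\neq f(u)$ or $f(g(u))=u$. (This problem is total.) $\mathsf{TFZPP}$ is the class of total $\mathsf{NP}$ search problems solvable by a distribution over polynomial-time algorithms that, on every input, either output a valid solution or $\bot$, outputting $\bot$ with probability at most $1/3$. $\textsc{Weak-Pigeon}$: given a circuit $h:\{0,1\}^n\to\{0,1\}^{n-1}$, find $x\neq y$ with $h(x)=h(y)$. $\mathsf{PWPP}$ is the class of total search problems polynomial-time many-one reducible to $\textsc{Weak-Pigeon}$. *)

(* Defs.v *)
From mathcomp Require Import all_boot all_order all_algebra.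
Set Implicit Arguments.
Unset Strict Implicit.
Unset Printing Implicit Defensive.
Import Order.TTheory GRing.Theory Num.Theory.

Notation bits := (seq bool).

(* [None] is the blank symbol, [Some (inl b)] the bit [b], and [Some (inr a)]
   an auxiliary symbol of the machine. *)
Definition symbol (A : finType) : finType := option (bool + A)%type.

Variant move := MoveL | Stay | MoveR.

Record machine := Machine {
  state : finType;
  aux : finType;
  tapes : nat; (* the machine has [tapes.+1] tapes, so at least one *)
  start : state;
  halting : pred state;
  delta : state -> {ffun 'I_tapes.+1 -> symbol aux} ->
          state * {ffun 'I_tapes.+1 -> symbol aux * move}
}.

(* A two-way infinite tape: the cells to the left of the head (nearest first),
   the scanned cell, and the cells to its right (nearest first). All the cells
   that are not listed are blank. *)
Record tape (A : finType) := Tape {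
  lefts : seq (symbol A);
  scanned : symbol A;
  rights : seq (symbol A)
}.

Definition tape_move (A : finType) (m : move) (t : tape A) : tape A :=
  let: Tape l c r := t in
  match m with
  | MoveL => Tape (behead l) (head None l) (c :: r)
  | Stay => t
  | MoveR => Tape (c :: l) (head None r) (behead r)
  end.

Definition tape_write (A : finType) (s : symbol A) (t : tape A) : tape A :=
  Tape (lefts t) s (rights t).

Definition bit_symbol (A : finType) (b : bool) : symbol A := Some (inl b).

Definition tape_of_bits (A : finType) (x : bits) : tape A :=
  let s := map (@bit_symbol A) x in Tape [::] (head None s) (behead s).

(* The longest run of bits that starts at the scanned cell and goes right. *)
Fixpoint leading_bits (A : finType) (s : seq (symbol A)) : bits :=
  if s is Some (inl b) :: s' then b :: leading_bits s' else [::].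

Definition bits_of_tape (A : finType) (t : tape A) : bits :=
  leading_bits (scanned t :: rights t).

Definition config (M : machine) : Type :=
  (state M * {ffun 'I_(tapes M).+1 -> tape (aux M)})%type.

Definition step (M : machine) (c : config M) : config M :=
  let: (q, ts) := c in
  if halting q then c else
  let: (q', act) := delta q [ffun i => scanned (ts i)] in
  (q', [ffun i => tape_move (act i).2 (tape_write (act i).1 (ts i))]).

(* The i-th input is written on tape i, with the head on its first bit;
   the other tapes are blank. *)
Definition initial (M : machine) (xs : seq bits) : config M :=
  (start M, [ffun i : 'I_(tapes M).+1 => tape_of_bits (aux M) (nth [::] xs i)]).

(* On inputs [xs], [M] halts within [t] steps with [y] on tape 0. *)
Definition computes_within (M : machine) (xs : seq bits) (y : bits) (t : nat) :
    Prop :=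
  let c := iter t (@step M) (initial M xs) in
  halting c.1 /\ bits_of_tape (c.2 ord0) = y.

Definition poly_time1 (F : bits -> bits) : Prop :=
  exists (M : machine) (p : {poly nat}), forall x,
    computes_within M [:: x] (F x) p.[size x]%R.

Definition poly_time2 (F : bits -> bits -> bits) : Prop :=
  exists (M : machine) (p : {poly nat}), forall x y,
    computes_within M [:: x; y] (F x y) p.[size x + size y]%R.

(* [R x y] means that [y] is a solution of the input [x]. *)
Definition search_problem := bits -> bits -> Prop.

Definition total (R : search_problem) : Prop := forall x, exists y, R x y.

Definition NP_search (R : search_problem) : Prop :=
  (exists p : {poly nat}, forall x y, R x y -> size y <= p.[size x]%R) /\
  (exists2 chi : bits -> bits -> bool,
     poly_time2 (fun x y => [:: chi x y]) & forall x y, R x y <-> chi x y).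

Definition TFNP (R : search_problem) : Prop := NP_search R /\ total R.

(* How a machine outputs either a solution or bot, which is [None]. *)
Definition code_answer (o : option bits) : bits :=
  if o is Some y then true :: y else [::].

Definition coin_prob (m : nat) (E : pred bits) : rat :=
  (#|[set r : m.-tuple bool | E r]|%:R / (2 ^+ m))%R.

(* A distribution over polynomial-time algorithms is a polynomial-time
   algorithm [A] whose second input is a uniformly random string, of length
   polynomial in that of the first one. *)
Definition TFZPP (R : search_problem) : Prop :=
  TFNP R /\
  exists (A : bits -> bits -> option bits) (q : {poly nat}),
    poly_time2 (fun x r => code_answer (A x r)) /\
    forall x,
      (forall (r : (q.[size x]%R).-tuple bool) y, A x r = Some y -> R x y) /\
      (coin_prob q.[size x] (fun r => A x r == None) <= 1 / 3%:R)%R.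

(* Many-one reductions: [F] maps inputs of [R] to inputs of [S], and [G] maps
   solutions back. *)
Definition reducible (R S : search_problem) : Prop :=
  exists (F : bits -> bits) (G : bits -> bits -> bits),
    [/\ poly_time1 F, poly_time2 G &
        forall x y, S (F x) y -> R x (G x y)].

Variant gate := And of nat & nat | Or of nat & nat | Not of nat.

(* Wires 0, ..., n-1 are the inputs, and gate k drives wire n + k. An index of
   a wire that does not exist (yet) reads as the constant false: in particular
   a gate can only depend on inputs and earlier gates. *)
Record circuit (n m : nat) := Circuit {
  gates : seq gate;
  outputs : m.-tuple nat
}.

Definition gate_value (ws : bits) (g : gate) : bool :=
  match g with
  | And i j => nth false ws i && nth false ws j
  | Or i j => nth false ws i || nth false ws j
  | Not i => ~~ nth false ws i
  end.

Definition eval (n m : nat) (C : circuit n m) (x : n.-tuple bool) :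
    m.-tuple bool :=
  let ws := foldl (fun ws g => rcons ws (gate_value ws g)) x (gates C) in
  [tuple of map (nth false ws) (outputs C)].

(* Prefix-free encodings. Numbers are in unary: a number is either the length
   of an input or the index of a wire, so this is polynomially related to
   binary in the size of the circuit. *)
Definition code_nat (k : nat) : bits := rcons (nseq k true) false.

Definition code_seq (T : Type) (code : T -> bits) (s : seq T) : bits :=
  rcons (flatten [seq true :: code a | a <- s]) false.

Definition code_gate (g : gate) : bits :=
  match g with
  | Not i => false :: code_nat i
  | And i j => [:: true, false & code_nat i ++ code_nat j]
  | Or i j => [:: true, true & code_nat i ++ code_nat j]
  end.

Definition code_circuit (n m : nat) (C : circuit n m) : bits :=
  code_seq code_gate (gates C) ++ code_seq code_nat (outputs C).

(* Search problems are relations on all bit strings. A string that does not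
   encode an instance gets the empty string as its only solution. *)

Definition code_nephew (n : nat) (f g : circuit n n) : bits :=
  code_nat n ++ code_circuit f ++ code_circuit g.

Definition nephew_solution (n : nat) (f g : n.-tuple bool -> n.-tuple bool)
    (u : n.-tuple bool) : Prop :=
  f (f (g u)) <> f u \/ f (g u) = u.

Definition Nephew : search_problem := fun x y =>
  (exists (n : nat) (f g : circuit n n) (u : n.-tuple bool),
     [/\ x = code_nephew f g, y = u & nephew_solution (eval f) (eval g) u]) \/
  (~ (exists (n : nat) (f g : circuit n n), x = code_nephew f g)) /\ y = [::].

(* The circuit has n.+1 inputs and n outputs. *)
Definition code_weak_pigeon (n : nat) (h : circuit n.+1 n) : bits :=
  code_nat n.+1 ++ code_circuit h.

Definition WeakPigeon : search_problem := fun x y =>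
  (exists (n : nat) (h : circuit n.+1 n) (a b : n.+1.-tuple bool),
     [/\ x = code_weak_pigeon h, y = a ++ b, a <> b & eval h a = eval h b]) \/
  (~ (exists (n : nat) (h : circuit n.+1 n), x = code_weak_pigeon h)) /\
  y = [::].

Definition PWPP (R : search_problem) : Prop :=
  TFNP R /\ reducible R WeakPigeon.

(* Main.v *)
(* If [u] is not a solution, then [v := f (g u)] is a sibling of [u]: it differs
   from [u] and has the same parent. If [v] is not a solution either, then
   [g u] and [g v] have distinct parents [v] and [f (g v)], which are both
   siblings of [u]. So a string of bits describes a descent from [0^n] along
   [g], each bit telling whether to pass to the sibling first, and two strings
   of the same length whose descents meet no solution end in distinct nodes:
   the f-ancestors of the ends differ where the strings first differ. Hence at
   most [2^n] strings of a given length miss every solution. With [n + 2] random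
   bits a descent fails with probability at most 1/4; with [n + 1] bits, the map
   from strings to ends is an instance of Weak-Pigeon, whose collisions give
   solutions.
   For the running times, programs on four bit stacks are compiled to machines,
   and each data type is coded by binary trees, serialized on the first stack. *)
From mathcomp Require Import all_boot all_algebra zify lra.
Require Import Defs.
Set Implicit Arguments.
Unset Strict Implicit.
Unset Printing Implicit Defensive.

(** * Stack programs and their compilation to machines *)

(** The combinatorial argument is short; the weight lies in polynomial time on concrete machines.
    Polynomial time is closed under composition only if output sizes are controlled, and under
    iteration only if the state stays small all along, since a fast step may square the size each
    time. So the predicate [PT] carries a bound on the output, and each fold comes with a bound on
    its growth; descents qualify because a node has as many bits as the circuit has outputs,
    whatever was fed to it. Two features of the encoding shape the rest. A string that is no code
    has a solution of its own, so parsers must recognize codes exactly. And circuits may refer to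
    missing wires, which read as false: when [f] and [g] are copied into the circuit of a descent,
    such a reference must not meet the output of a foreign gate. *)

Definition store := seq bits.

Variant stack_op := Push of 'I_4 & bool | Pop of 'I_4.

Definition update (s : store) (i : nat) (w : bits) : store := set_nth [::] s i w.

Definition do_op (o : stack_op) (s : store) : store :=
  match o with
  | Push i b => update s i (b :: nth [::] s i)
  | Pop i => update s i (behead (nth [::] s i))
  end.

(* [Case i] and [Loop i] pop stack [i] before they branch on the popped bit;
   [Loop i] goes on as long as that bit is [true]. *)
Inductive cmd :=
  | Op of stack_op
  | Seq of cmd & cmd
  | Case of 'I_4 & cmd & cmd & cmd
  | Loop of 'I_4 & cmd.

Definition top (s : store) (i : nat) : option bool := ohead (nth [::] s i).

(** The number counts stack operations, a branch or loop test costing the one pop that it performs.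
    It is thus also the number of transitions between program points. *)
Inductive exec : cmd -> store -> nat -> store -> Prop :=
  | ExecOp o s : exec (Op o) s 1 (do_op o s)
  | ExecSeq c d s n s1 m s2 :
      exec c s n s1 -> exec d s1 m s2 -> exec (Seq c d) s (n + m) s2
  | ExecCase (i : 'I_4) c d e s n s' :
      exec (match top s i with
            | Some true => c | Some false => d | None => e end)
        (do_op (Pop i) s) n s' ->
      exec (Case i c d e) s n.+1 s'
  | ExecExit (i : 'I_4) c s : top s i != Some true ->
      exec (Loop i c) s 1 (do_op (Pop i) s)
  | ExecLoop (i : 'I_4) c s n s1 m s2 : top s i = Some true ->
      exec c (do_op (Pop i) s) n s1 -> exec (Loop i c) s1 m s2 ->
      exec (Loop i c) s (n + m).+1 s2.

(** Program points, one per stack operation, as nested sums: the state set is finite by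
    construction. [None] is the pop that precedes a branch. *)
Fixpoint control (c : cmd) : finType :=
  match c with
  | Op _ => unit
  | Seq c d => (control c + control d)%type
  | Case _ c d e => option (control c + (control d + control e))%type
  | Loop _ c => option (control c)
  end.

Fixpoint entry (c : cmd) : control c :=
  match c with
  | Op _ => tt
  | Seq c d => inl (entry c)
  | Case _ c d e => None
  | Loop _ c => None
  end.

(** The tops [t] are those before the operation, so a branch is chosen on the bit that its own pop
    removes. A resulting [None] leaves the command. *)
Fixpoint next (c : cmd) (t : 'I_4 -> option bool) :
    control c -> stack_op * option (control c) :=
  match c with
  | Op o => fun _ => (o, None)
  | Seq c d => fun q =>
      match q with
      | inl q => let: (o, q') := next t q in
                 (o, Some (if q' is Some r then inl r else inr (entry d)))
      | inr q => let: (o, q') := next t q in (o, omap inr q')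
      end
  | Case i c d e => fun q =>
      match q with
      | None => (Pop i, Some (Some (match t i with
                                    | Some true => inl (entry c)
                                    | Some false => inr (inl (entry d))
                                    | None => inr (inr (entry e)) end)))
      | Some (inl q) => let: (o, q') := next t q in
                        (o, omap (fun r => Some (inl r)) q')
      | Some (inr (inl q)) => let: (o, q') := next t q in
                        (o, omap (fun r => Some (inr (inl r))) q')
      | Some (inr (inr q)) => let: (o, q') := next t q in
                        (o, omap (fun r => Some (inr (inr r))) q')
      end
  | Loop i c => fun q =>
      match q with
      | None => (Pop i, if t i is Some true then Some (Some (entry c)) else None)
      | Some q => let: (o, q') := next t q in (o, Some q')
      end
  end.

Inductive runs (c : cmd) : control c -> store -> nat -> store -> Prop :=
  | RunsExit q s o : next (fun i => top s i) q = (o, None) ->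
      runs q s 1 (do_op o s)
  | RunsNext q s o q' n s' : next (fun i => top s i) q = (o, Some q') ->
      runs q' (do_op o s) n s' -> runs q s n.+1 s'.

(** Covers the parts whose exit is an exit of the whole command: the second half of a [Seq] and the
    branches of a [Case]. The first half of a [Seq] and the body of a [Loop] have their exits
    redirected, hence the two separate inductions below. *)
Lemma runs_embed c d (F : control c -> control d) q s n s' :
  (forall t q, next t (F q) = ((next t q).1, omap F (next t q).2)) ->
  runs q s n s' -> runs (F q) s n s'.
Proof.
move=> HF; elim=> {q s n s'} [q s o Ho|q s o q' n s' Ho _ IH].
  by apply: RunsExit; rewrite HF Ho.
by apply: RunsNext IH; rewrite HF Ho.
Qed.

Lemma runs_seql c d (q : control c) s n s1 m s2 :
  runs q s n s1 -> runs (entry d) s1 m s2 ->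
  @runs (Seq c d) (inl q) s (n + m) s2.
Proof.
move=> Hq Hd0; have {Hd0} : @runs (Seq c d) (inr (entry d)) s1 m s2.
  by apply: (@runs_embed d (Seq c d) inr) Hd0 => t r /=; case: (next t r).
move=> Hd; elim: Hq Hd => {q s n s1} [q s o Ho|q s o q' n s' Ho _ IH] Hd.
  by rewrite add1n; apply: RunsNext Hd; rewrite /= Ho.
by rewrite addSn; apply: RunsNext (IH Hd); rewrite /= Ho.
Qed.

Lemma runs_loop i c (q : control c) s n s1 m s2 :
  runs q s n s1 -> runs (entry (Loop i c)) s1 m s2 ->
  @runs (Loop i c) (Some q) s (n + m) s2.
Proof.
move=> Hq Hd; elim: Hq Hd => {q s n s1} [q s o Ho|q s o q' n s' Ho _ IH] Hd.
  by rewrite add1n; apply: RunsNext Hd; rewrite /= Ho.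
by rewrite addSn; apply: RunsNext (IH Hd); rewrite /= Ho.
Qed.

Lemma exec_runs c s n s' : exec c s n s' -> runs (entry c) s n s'.
Proof.
elim=> {c s n s'}.
- by move=> o s; apply: RunsExit.
- move=> c d s n s1 m s2 _ IHc _ IHd; exact: runs_seql IHc IHd.
- move=> i c d e s n s' _; case E: (top s i) => [[]|] IH.
  + apply: (@RunsNext (Case i c d e) _ _ (Pop i) (Some (inl (entry c)))).
      by rewrite /= E.
    apply: (@runs_embed c (Case i c d e) (fun q => Some (inl q))) IH.
    by move=> t q /=; case: (next t q).
  + apply: (@RunsNext (Case i c d e) _ _ (Pop i) (Some (inr (inl (entry d))))).
      by rewrite /= E.
    apply: (@runs_embed d (Case i c d e) (fun q => Some (inr (inl q)))) IH.
    by move=> t q /=; case: (next t q).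
  + apply: (@RunsNext (Case i c d e) _ _ (Pop i) (Some (inr (inr (entry e))))).
      by rewrite /= E.
    apply: (@runs_embed e (Case i c d e) (fun q => Some (inr (inr q)))) IH.
    by move=> t q /=; case: (next t q).
- move=> i c s E; apply: (@RunsExit (Loop i c)) => /=.
  by case: (top s i) E => [[]|].
- move=> i c s n s1 m s2 E _ IHc _ IHl.
  apply: (@RunsNext (Loop i c) _ _ (Pop i) (Some (entry c))); first by rewrite /= E.
  exact: runs_loop IHc IHl.
Qed.

(** * Simulation of programs by multi-tape machines *)

Definition symbol_bit (a : symbol void) : option bool :=
  if a is Some (inl b) then Some b else None.

Section Compile.
Variable c : cmd.

(* A push takes two steps of the machine: move left, then write. *)
Definition cstate : finType := (option (control c) * option ('I_4 * bool))%type.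

Definition cdelta (q : cstate) (rd : {ffun 'I_4 -> symbol void}) :
    cstate * {ffun 'I_4 -> symbol void * move} :=
  match q.2 with
  | Some (i, b) =>
      ((q.1, None), [ffun j => (if j == i then bit_symbol void b else rd j, Stay)])
  | None =>
    if q.1 is Some r then
      let: (o, q') := next (fun i => symbol_bit (rd i)) r in
      match o with
      | Push i b =>
          ((q', Some (i, b)), [ffun j => (rd j, if j == i then MoveL else Stay)])
      | Pop i => ((q', None), [ffun j => (rd j, if j == i then MoveR else Stay)])
      end
    else (q, [ffun j => (rd j, Stay)])
  end.

Definition cmachine : machine :=
  @Machine cstate void 3 (Some (entry c), None)
    (fun q => q == (None, None) :> cstate) cdelta.

(* The cells to the left of the head are arbitrary: popped symbols stay there. *)
Definition tape_stack (t : tape void) (w : bits) : Prop :=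
  forall n, nth None (scanned t :: rights t) n = nth None (map (@bit_symbol void) w) n.

Definition tapes_store (ts : {ffun 'I_4 -> tape void}) (s : store) : Prop :=
  forall i, tape_stack (ts i) (nth [::] s i).

Lemma tape_stack_top t w : tape_stack t w -> symbol_bit (scanned t) = ohead w.
Proof. by move/(_ 0) => /= ->; case: w. Qed.

Lemma next_ext (d : cmd) t t' (q : control d) : t =1 t' -> next t q = next t' q.
Proof.
move=> E; elim: d q => [o|d1 IH1 d2 IH2|i d1 IH1 d2 IH2 d3 IH3|i d1 IH1] //=.
- by case=> q; rewrite (IH1, IH2).
- by case=> [[q|[q|q]]|]; rewrite ?(IH1, IH2, IH3, E).
- by case=> [q|]; rewrite ?(IH1, E).
Qed.

Lemma step_cdelta (q : cstate) ts : q != (None, None) ->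
  @step cmachine (q, ts) =
  let: (q', act) := cdelta q [ffun i => scanned (ts i)] in
  (q', [ffun i => tape_move (act i).2 (tape_write (act i).1 (ts i))]).
Proof. by rewrite /step /= => /negbTE ->. Qed.

Lemma sim_op q s o q' (ts : {ffun 'I_4 -> tape void}) :
  tapes_store ts s -> next (fun i => top s i) q = (o, q') ->
  exists k ts', [/\ k <= 2, tapes_store ts' (do_op o s) &
    iter k (@step cmachine) ((Some q, None), ts) = ((q', None), ts')].
Proof.
move=> Hts Ho.
have Ho' : next (fun i => symbol_bit ([ffun i => scanned (ts i)] i)) q = (o, q').
  by rewrite -Ho; apply: next_ext => i; rewrite ffunE; apply: tape_stack_top.
case: o Ho Ho' => [i b|i] Ho Ho'.
- exists 2; eexists; split; [by []| |]; last first.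
    rewrite [iter 2 _ _]iterS [iter 1 _ _]iterS [iter 0 _ _]/=. rewrite step_cdelta // /cdelta /= Ho' step_cdelta; last by rewrite xpair_eqE andbF.
    by rewrite /cdelta /=; reflexivity.
  move=> j n; rewrite !ffunE /update nth_set_nth /=.
  rewrite (inj_eq val_inj); case: eqVneq => [->|_].
    move: (Hts i); case: (ts i) => l a r /= H.
    by case: n => [|n] //=; apply: H.
  by have := Hts j n; case: (ts j).
- exists 1; eexists; split; [by []| |]; last first.
    by rewrite iterS [iter 0 _ _]/= step_cdelta // /cdelta /= Ho'; reflexivity.
  move=> j n; rewrite !ffunE /update nth_set_nth /=.
  rewrite (inj_eq val_inj); case: eqVneq => [->|_].
    move: (Hts i); case: (ts i) => l a r /= H.
    (* Past the listed cells the machine scans a blank, which is also the default of [nth]. *)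
    have -> : nth None (head None r :: behead r) n = nth None r n.
      by case: (r) => [|? ?]; case: (n) => [|k]; rewrite //= nth_nil.
    by rewrite [LHS](H n.+1); case: (nth [::] s i) => //=; rewrite nth_nil.
  by have := Hts j n; case: (ts j).
Qed.

Lemma sim_runs q s n s' ts : runs q s n s' -> tapes_store ts s ->
  exists k ts', [/\ k <= n.*2, tapes_store ts' s' &
    iter k (@step cmachine) ((Some q, None), ts) = ((None, None), ts')].
Proof.
move=> H; elim: H ts => {q s n s'} [q s o Ho|q s o q' n s' Ho _ IH] ts Hts.
  exact: sim_op Hts Ho.
have [k [ts1 [lek Hts1 E1]]] := sim_op Hts Ho.
have [k' [ts2 [lek' Hts2 E2]]] := IH _ Hts1.
exists (k' + k), ts2; split=> //; last by rewrite iterD E1.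
by rewrite doubleS -addn2 leq_add.
Qed.

Lemma leading_bits_stack l w :
  (forall n, nth None l n = nth None (map (@bit_symbol void) w) n) ->
  leading_bits l = w.
Proof.
elim: w l => [|b w IH] [|a l] H //.
- by rewrite /= (H 0 : a = None).
- by have := H 0.
- rewrite /= (H 0 : a = bit_symbol void b) /=; congr cons.
  by apply: IH => n; apply: (H n.+1).
Qed.

Lemma cmachine_computes x y n s' T :
  exec c [:: x; y; [::]; [::]] n s' -> n.*2 <= T ->
  computes_within cmachine [:: x; y] (nth [::] s' 0) T.
Proof.
move=> /exec_runs H leT.
have H0 : tapes_store (initial cmachine [:: x; y]).2 [:: x; y; [::]; [::]].
  move=> i k; rewrite /initial /= ffunE.
  have -> : nth [::] [:: x; y; [::]; [::]] i = nth [::] [:: x; y] i.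
    by case: i => [[|[|[|[|]]]]].
  case: (nth [::] [:: x; y] i) => [|? ?] //; case: k => [|k] //=; rewrite ?nth_nil //.
have [k [ts [lek Hts E]]] := sim_runs H H0.
have {}E : iter T (@step cmachine) (initial cmachine [:: x; y]) = ((None, None), ts).
  rewrite -(subnK (leq_trans lek leT)) iterD [iter k _ _]E.
  (* A halted configuration is a fixed point of [step], so the surplus steps are harmless. *)
  by elim: (T - k) => //= m ->.
split; rewrite E //=.
by apply: leading_bits_stack; apply: (Hts ord0).
Qed.

End Compile.

(** * Programs on serialized trees *)

Definition within (c : cmd) (s s' : store) (T : nat) : Prop :=
  exists2 n, n <= T & exec c s n s'.

Lemma within_le c s s' T T' : within c s s' T -> T <= T' -> within c s s' T'.
Proof. by move=> [n len H] le; exists n => //; apply: leq_trans le. Qed.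

Lemma within_op o s : within (Op o) s (do_op o s) 1.
Proof. by exists 1 => //; constructor. Qed.

Lemma within_seq c d s s1 s2 T1 T2 :
  within c s s1 T1 -> within d s1 s2 T2 -> within (Seq c d) s s2 (T1 + T2).
Proof.
move=> [n len Hn] [m lem Hm]; exists (n + m); first exact: leq_add.
exact: ExecSeq Hn Hm.
Qed.

Lemma within_case (i : 'I_4) c d e s s' T :
  within (match top s i with
          | Some true => c | Some false => d | None => e end)
    (do_op (Pop i) s) s' T ->
  within (Case i c d e) s s' T.+1.
Proof. by move=> [n len Hn]; exists n.+1 => //; constructor. Qed.

Lemma within_exit (i : 'I_4) c s : top s i != Some true ->
  within (Loop i c) s (do_op (Pop i) s) 1.
Proof. by exists 1 => //; constructor. Qed.

Lemma within_loop (i : 'I_4) c s s1 s2 T1 T2 : top s i = Some true ->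
  within c (do_op (Pop i) s) s1 T1 -> within (Loop i c) s1 s2 T2 ->
  within (Loop i c) s s2 (T1 + T2).+1.
Proof.
move=> E [n len Hn] [m lem Hm]; exists (n + m).+1; first exact: leq_add.
exact: ExecLoop E Hn Hm.
Qed.

Definition r0 : 'I_4 := @Ordinal 4 0 isT.
Definition r1 : 'I_4 := @Ordinal 4 1 isT.
Definition r2 : 'I_4 := @Ordinal 4 2 isT.
Definition r3 : 'I_4 := @Ordinal 4 3 isT.

Inductive tree := Leaf | Node of tree & tree.

(** Preorder is self-delimiting: the tree on top of a stack can be read off without knowing what
    lies below, so specifications can leave the rest [a] arbitrary. *)
Fixpoint ser (t : tree) : bits :=
  if t is Node l r then true :: ser l ++ ser r else [:: false].

Lemma size_ser_gt0 t : 0 < size (ser t).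
Proof. by case: t. Qed.

(* The counter on stack 3 is the number of trees that remain to be read;
   [P b] is run on each bit [b] of the tree on top of stack 0. *)
Definition grab_body (P : bool -> cmd) : cmd :=
  Case r0 (Seq (P true) (Seq (Op (Push r3 true)) (Op (Push r3 true))))
    (P false) (P false).

Definition grab (P : bool -> cmd) : cmd :=
  Seq (Op (Push r3 false)) (Seq (Op (Push r3 true)) (Loop r3 (grab_body P))).

Section Grab.
Variables (P : bool -> cmd) (f g : bool -> bits -> bits) (K : nat).
Hypothesis HP : forall b a B C D,
  within (P b) [:: a; B; C; D] [:: a; f b B; g b C; D] K.

(** Stated with the remaining run as a hypothesis so that the induction composes: the run on the
    right subtree is the remainder for the left one. A bit costs the pop of the counter, the pop of
    the bit, [K], and at most two pushes. *)
Lemma grab_loop t a B C D s' T :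
  within (Loop r3 (grab_body P))
    [:: a; foldl (fun w b => f b w) B (ser t);
        foldl (fun w b => g b w) C (ser t); D] s' T ->
  within (Loop r3 (grab_body P)) [:: ser t ++ a; B; C; true :: D] s'
    (size (ser t) * (K + 4) + T).
Proof.
elim: t a B C D T => [|l IHl r IHr] a B C D T H.
  apply: within_le (within_loop (T1 := K.+1) _ _ H) _; first by [].
    by apply: within_case; apply: HP.
  by rewrite /=; lia.
have {}H : within (Loop r3 (grab_body P))
    [:: ser l ++ ser r ++ a; f true B; g true C; true :: true :: D] s'
    (size (ser l) * (K + 4) + (size (ser r) * (K + 4) + T)).
  by apply: IHl; apply: IHr; move: H; rewrite /= !foldl_cat.
apply: within_le (within_loop (T1 := (K + (1 + 1)).+1) _ _ H) _; first by [].
  rewrite /= -catA; apply: within_case; apply: within_seq (HP _ _ _ _ _) _.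
  exact: within_seq (within_op _ _) (within_op _ _).
by rewrite /= size_cat; lia.
Qed.

Lemma grabP t a B C D :
  within (grab P) [:: ser t ++ a; B; C; D]
    [:: a; foldl (fun w b => f b w) B (ser t);
        foldl (fun w b => g b w) C (ser t); D] (size (ser t) * (K + 7)).
Proof.
have /grab_loop H : within (Loop r3 (grab_body P))
    [:: a; foldl (fun w b => f b w) B (ser t);
        foldl (fun w b => g b w) C (ser t); false :: D]
    [:: a; foldl (fun w b => f b w) B (ser t);
        foldl (fun w b => g b w) C (ser t); D] 1 by apply: within_exit.
eapply within_le; first by do 2 (eapply within_seq; first exact: within_op); exact: H.
(* Two initial pushes and the exit of the loop cost 3, absorbed because a serialization is not
   empty. *)
by have := size_ser_gt0 t; lia.
Qed.

End Grab.

(* The flag [true] above each bit and a [false] below the word let [unmark] find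
   the end of the word. *)
Definition marked (B w : bits) : bits := foldl (fun B b => true :: b :: B) B w.

Lemma marked_rcons B w b : marked B (rcons w b) = true :: b :: marked B w.
Proof. by rewrite /marked -cats1 foldl_cat. Qed.

Definition mark (i : 'I_4) (b : bool) : cmd := Seq (Op (Push i b)) (Op (Push i true)).

Lemma withinE c s s' s'' T : within c s s' T -> s' = s'' -> within c s s'' T.
Proof. by move=> H <-. Qed.

Definition unmark (i : 'I_4) : cmd :=
  Loop i (Case i (Op (Push r0 true)) (Op (Push r0 false)) (Op (Push r0 false))).

Lemma unmark1 w a B C D :
  within (unmark r1) [:: a; marked (false :: B) w; C; D] [:: w ++ a; B; C; D]
    (size w * 3 + 1).
Proof.
elim/last_ind: w a => [|w b IH] a; first exact: within_exit.
rewrite marked_rcons size_rcons -cats1 -catA mulSn -addnA.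
apply: within_le (within_loop (T1 := 2) _ _ (IH _)) _ => //.
by apply: within_case; case: b; apply: within_op.
Qed.

Lemma unmark2 w a B C D :
  within (unmark r2) [:: a; B; marked (false :: C) w; D] [:: w ++ a; B; C; D]
    (size w * 3 + 1).
Proof.
elim/last_ind: w a => [|w b IH] a; first exact: within_exit.
rewrite marked_rcons size_rcons -cats1 -catA mulSn -addnA.
apply: within_le (within_loop (T1 := 2) _ _ (IH _)) _ => //.
by apply: within_case; case: b; apply: within_op.
Qed.

(** Grabbing a word onto a side stack reverses it and unmarking reverses it back, leaving the side
    stack as it was. *)
Definition dup : cmd :=
  Seq (Op (Push r1 false)) (Seq (Op (Push r2 false))
    (Seq (grab (fun b => Seq (mark r1 b) (mark r2 b))) (Seq (unmark r1) (unmark r2)))).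

Lemma dupP t a B C D :
  within dup [:: ser t ++ a; B; C; D] [:: ser t ++ ser t ++ a; B; C; D]
    (size (ser t) * 30).
Proof.
have HP b a' B' C' D' : within (Seq (mark r1 b) (mark r2 b))
    [:: a'; B'; C'; D'] [:: a'; true :: b :: B'; true :: b :: C'; D'] ((1 + 1) + (1 + 1)).
  by apply: within_seq; apply: within_seq; apply: within_op.
eapply within_le.
  do 2 (eapply within_seq; first exact: within_op).
  eapply within_seq; first exact: (grabP HP).
  by eapply within_seq; [apply: unmark1 | apply: unmark2].
by have := size_ser_gt0 t; lia.
Qed.

Definition swap : cmd :=
  Seq (Op (Push r1 false)) (Seq (Op (Push r2 false))
    (Seq (grab (mark r1)) (Seq (grab (mark r2)) (Seq (unmark r1) (unmark r2))))).

Lemma swapP t u a B C D :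
  within swap [:: ser t ++ ser u ++ a; B; C; D] [:: ser u ++ ser t ++ a; B; C; D]
    ((size (ser t) + size (ser u)) * 30).
Proof.
have H1 b a' B' C' D' : within (mark r1 b)
    [:: a'; B'; C'; D'] [:: a'; true :: b :: B'; C'; D'] (1 + 1).
  by apply: within_seq; apply: within_op.
have H2 b a' B' C' D' : within (mark r2 b)
    [:: a'; B'; C'; D'] [:: a'; B'; true :: b :: C'; D'] (1 + 1).
  by apply: within_seq; apply: within_op.
have E w : forall s : bits, foldl (fun w b => w) w s = w by elim.
have G1 := @grabP _ _ (fun _ w => w) _ H1.
have G2 := @grabP _ (fun _ w => w) _ _ H2.
eapply within_le.
  do 2 (eapply within_seq; first exact: within_op).
  eapply within_seq; first by apply: withinE (G1 _ _ _ _ _) _; rewrite E.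
  eapply within_seq; first by apply: withinE (G2 _ _ _ _ _) _; rewrite E.
  by eapply within_seq; [apply: unmark1 | apply: unmark2].
by have := size_ser_gt0 t; have := size_ser_gt0 u; lia.
Qed.

(** A push followed by a pop stands for the idle command. *)
Definition drop_tree : cmd := grab (fun b => Seq (Op (Push r1 b)) (Op (Pop r1))).

Lemma drop_treeP t a B C D :
  within drop_tree [:: ser t ++ a; B; C; D] [:: a; B; C; D] (size (ser t) * 30).
Proof.
have H b a' B' C' D' : within (Seq (Op (Push r1 b)) (Op (Pop r1)))
    [:: a'; B'; C'; D'] [:: a'; B'; C'; D'] (1 + 1).
  by apply: within_seq; apply: within_op.
have E w : forall s : bits, foldl (fun w b => w) w s = w by elim.
have G := @grabP _ (fun _ w => w) (fun _ w => w) _ H.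
by apply: within_le (withinE (G t a B C D) _) _; rewrite ?E; last lia.
Qed.

Definition push_seq (w : bits) : cmd :=
  foldr (fun b c => Seq c (Op (Push r0 b))) (Seq (Op (Push r0 true)) (Op (Pop r0))) w.

Lemma push_seqP w a B C D :
  within (push_seq w) [:: a; B; C; D] [:: w ++ a; B; C; D] (size w + 2).
Proof.
elim: w => [|b w IH]; first by apply: (@within_seq _ _ _ _ _ 1 1); apply: within_op.
eapply within_le; first by eapply within_seq; [apply: IH | apply: within_op].
by rewrite /=; lia.
Qed.

(** * Polynomial-time functions between coded types *)

Class coded (A : Type) := tree_of : A -> tree.

Section Codes.
Variables (A B : Type) (cA : coded A) (cB : coded B).

#[global] Instance coded_unit : coded unit := fun _ => Leaf.

(** Booleans and numbers have the trees of lists of units, and an option that of a list of length at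
    most one; recoding then costs nothing. *)
#[global] Instance coded_bool : coded bool :=
  fun b => if b then Node Leaf Leaf else Leaf.

#[global] Instance coded_nat : coded nat :=
  fix c n := if n is m.+1 then Node Leaf (c m) else Leaf.

#[global] Instance coded_prod : coded (A * B) :=
  fun p => Node (tree_of p.1) (tree_of p.2).

#[global] Instance coded_seq : coded (seq A) :=
  fix c s := if s is x :: s' then Node (tree_of x) (c s') else Leaf.

#[global] Instance coded_option : coded (option A) :=
  fun o => if o is Some x then Node (tree_of x) Leaf else Leaf.

(** The tree of a triple of numbers, with tag 0, 1 or 2 and a dummy second operand for [Not]. *)
#[global] Instance coded_gate : coded gate := fun g =>
  let c t i j := Node t (Node (tree_of i) (tree_of j)) in
  match g with
  | And i j => c Leaf i j
  | Or i j => c (Node Leaf Leaf) i j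
  | Not i => c (Node Leaf (Node Leaf Leaf)) i 0
  end.

End Codes.

Definition enc (A : Type) (cA : coded A) (x : A) : bits := ser (tree_of x).
Definition sz (A : Type) (cA : coded A) (x : A) : nat := size (enc cA x).
Arguments enc {A cA} x.
Arguments sz {A cA} x.

(** With a base of at least 2, a larger exponent absorbs constants and sums, so no coefficients are
    carried along. *)
Definition PB (A : Type) (cA : coded A) (f : A -> nat) : Prop :=
  exists k, forall x, f x <= (sz x + 2) ^ k.
Arguments PB {A cA} f.

(** The bound on the output serves composition, where the second program is timed in the size of the
    first result. The arbitrary [a], [B], [C], [D] act as a frame: programs run above any saved
    data. *)
Definition PT (A B : Type) (cA : coded A) (cB : coded B) (f : A -> B) : Prop :=
  (exists c T, PB T /\ forall x a B C D,
     within c [:: enc x ++ a; B; C; D] [:: enc (f x) ++ a; B; C; D] (T x)) /\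
  PB (fun x => sz (f x)).
Arguments PT {A B cA cB} f.

Lemma PT_ext (A B : Type) (cA : coded A) (cB : coded B) (f g : A -> B) :
  PT f -> f =1 g -> PT g.
Proof.
move=> [[c [T [HT H]]] [k Hk]] E; split; last by exists k => x; rewrite -E.
by exists c, T; split=> // x *; rewrite -E.
Qed.

Section Bounds.
Variables (A : Type) (cA : coded A).
Implicit Types f g : A -> nat.

Lemma PB_le f g : PB g -> (forall x, f x <= g x) -> PB f.
Proof. by move=> [k Hk] H; exists k => x; apply: leq_trans (H x) (Hk x). Qed.

Lemma PB_const n : PB (fun _ : A => n).
Proof.
exists n => x; apply: leq_trans (ltnW (ltn_expl n (leqnn 2))) _.
by case: n => // n; rewrite leq_exp2r // leq_addl.
Qed.

Lemma PB_sz : PB (fun x : A => sz x).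
Proof. by exists 1 => x; rewrite leq_addr. Qed.

Lemma leq_exp_sz (x : A) i j : i <= j -> (sz x + 2) ^ i <= (sz x + 2) ^ j.
Proof. by apply: leq_pexp2l; rewrite addn2. Qed.

Lemma PB_add f g : PB f -> PB g -> PB (fun x => f x + g x).
Proof.
move=> [i Hi] [j Hj]; exists (maxn i j).+1 => x.
rewrite expnS; have := Hi x; have := Hj x.
have := leq_exp_sz x (leq_maxl i j); have := leq_exp_sz x (leq_maxr i j).
have : 2 * (sz x + 2) ^ maxn i j <= (sz x + 2) * (sz x + 2) ^ maxn i j.
  by rewrite leq_mul2r leq_addl orbT.
by lia.
Qed.

Lemma PB_mul f g : PB f -> PB g -> PB (fun x => f x * g x).
Proof.
move=> [i Hi] [j Hj]; exists (i + j) => x.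
by rewrite expnD leq_mul.
Qed.

Lemma PB_exp f k : PB f -> PB (fun x => f x ^ k).
Proof.
move=> [i Hi]; exists (i * k) => x; rewrite expnM.
by case: k => // k; rewrite leq_exp2r.
Qed.

Lemma PB_comp (B : Type) (cB : coded B) (h : A -> B) (f : B -> nat) :
  PB (fun x => sz (h x)) -> PB f -> PB (fun x => f (h x)).
Proof.
move=> Hh [k Hk]; apply: PB_le (fun x => Hk (h x)).
exact: PB_exp (PB_add Hh (PB_const 2)).
Qed.

End Bounds.

Arguments PB_const {A cA} n.
Arguments PB_sz {A cA}.

Lemma sz_gt0 (A : Type) {cA : coded A} (x : A) : 0 < sz x.
Proof. exact: size_ser_gt0. Qed.

Lemma sz_pair (A B : Type) (cA : coded A) (cB : coded B) (x : A) (y : B) :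
  sz (x, y) = (sz x + sz y).+1.
Proof. by rewrite /sz /enc /= size_cat. Qed.

Lemma sz_cons (A : Type) (cA : coded A) (x : A) (s : seq A) :
  sz (x :: s) = (sz x + sz s).+1.
Proof. by rewrite /sz /enc /= size_cat. Qed.

Lemma sz_some (A : Type) (cA : coded A) (x : A) : sz (Some x) = (sz x).+2.
Proof. by rewrite /sz /enc /= size_cat addn1. Qed.

Lemma sz_nil (A : Type) (cA : coded A) : sz (@nil A) = 1.
Proof. by []. Qed.

Lemma sz_nat n : sz n = n.*2.+1.
Proof. by elim: n => // n IH; rewrite {1}/sz /enc /= -[size _]/(sz n) IH. Qed.

Lemma size_sz (A : Type) {cA : coded A} (s : seq A) : size s < sz s.
Proof. by elim: s => //= x s IH; rewrite sz_cons; lia. Qed.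

(* Leaves two results on stack 0, the second one on top. *)
Definition both (c d : cmd) : cmd := Seq dup (Seq c (Seq swap d)).

Lemma PB_S (A : Type) (cA : coded A) (f : A -> nat) : PB f -> PB (fun x => (f x).+1).
Proof. by move=> Hf; apply: PB_le (PB_add Hf (PB_const 1)) _ => x; rewrite addn1. Qed.

Lemma PB_seq_case (E A : Type) (cE : coded E) (cA : coded A)
    (l : E -> seq A) (f : E * (A * seq A) -> nat) :
  PB (fun e => sz (l e)) -> PB f ->
  PB (fun e => if l e is x :: s then f (e, (x, s)) else 0).
Proof.
move=> Hl [k Hk].
apply: PB_le (PB_exp k (PB_add (PB_add (PB_sz) Hl) (PB_const 3))) _ => e.
case: (l e) => [|x s] //; apply: leq_trans (Hk _) _.
by case: k {Hk} => // k; rewrite leq_exp2r // !sz_pair sz_cons; lia.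
Qed.

Lemma PT_size (A B : Type) (cA : coded A) (cB : coded B) (f : A -> B) :
  PT f -> PB (fun x => sz (f x)).
Proof. by case. Qed.

(** The list is its own loop counter: [Loop] pops its root bit, [true] for a cons, then the head is
    dropped and the tail brought back on top after [d]. *)
Definition iter_loop (d : cmd) : cmd :=
  Loop r0 (Seq drop_tree (Seq swap (Seq d swap))).

Lemma iter_loopP (A B : Type) (cA : coded A) (cB : coded B) (f : B -> B) d U :
  (forall (x : B) a b c d', within d [:: enc x ++ a; b; c; d'] [:: enc (f x) ++ a; b; c; d'] (U x)) ->
  forall (s : seq A) (x : B) a b c d' n m u,
  sz s <= n -> (forall i, i <= size s -> sz (iter i f x) <= m) ->
  (forall i, i < size s -> U (iter i f x) <= u) ->
  within (iter_loop d) [:: enc s ++ enc x ++ a; b; c; d']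
    [:: enc (iter (size s) f x) ++ a; b; c; d'] (size s * (200 * n + 200 * m + u) + 1).
Proof.
move=> Hd; elim=> [|y s IH] x a b c d' n m u Hn Hm Hu; first exact: within_exit.
rewrite [size _]/= iterSr.
rewrite sz_cons in Hn.
eapply within_le.
  apply: within_loop => //; last first.
    apply: (IH (f x) a b c d' n m u); first lia.
      by move=> i lei; rewrite -iterSr; apply: Hm.
    by move=> i lei; rewrite -iterSr; apply: Hu.
  rewrite /do_op /update /= -catA.
  apply: within_seq; first exact: drop_treeP.
  apply: within_seq; first exact: swapP.
  apply: within_seq; first exact: Hd.
  exact: swapP.
have := Hm 0 isT; have := Hm 1 isT; have := Hu 0 isT => /=.
have -> : size (ser (tree_of y)) = sz y by [].
have -> : size (ser (tree_of (f x))) = sz (f x) by [].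
have -> : size (ser (tree_of x)) = sz x by [].
have -> : size (ser (tree_of s)) = sz s by [].
by lia.
Qed.

Section Combinators.
Variables (E : Type) (cE : coded E).

Lemma PT_id : PT (fun e : E => e).
Proof.
split; last exact: PB_sz.
exists (push_seq [::]), (fun _ => 2); split; first exact: PB_const.
by move=> *; apply: push_seqP.
Qed.

Lemma PT_comp (A B : Type) (cA : coded A) (cB : coded B) (f : A -> B) (g : E -> A) :
  PT f -> PT g -> PT (fun e => f (g e)).
Proof.
move=> [[c [T [HT H]]] Hf] [[d [U [HU K]]] Hg]; split; last exact: PB_comp Hg Hf.
exists (Seq d c), (fun e => U e + T (g e)); split.
  exact: PB_add HU (PB_comp Hg HT).
by move=> *; apply: within_seq; [apply: K | apply: H].
Qed.

Lemma PT_const (A : Type) (cA : coded A) (x : A) : PT (fun _ : E => x).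
Proof.
split; last exact: PB_const.
exists (Seq drop_tree (push_seq (enc x))), (fun e => sz e * 30 + (sz x + 2)); split.
  by apply: PB_add (PB_const _); apply: PB_mul (PB_sz) (PB_const _).
by move=> *; apply: within_seq; [apply: drop_treeP | apply: push_seqP].
Qed.

Lemma bothP (A B : Type) (cA : coded A) (cB : coded B) (f : E -> A) (g : E -> B) :
  PT f -> PT g ->
  exists c T, PB T /\ forall e a B C D,
    within c [:: enc e ++ a; B; C; D] [:: enc (f e) ++ enc (g e) ++ a; B; C; D] (T e).
Proof.
move=> [[c [T [HT H]]] Hf] [[d [U [HU K]]] Hg].
exists (both d c), (fun e => sz e * 30 + (U e + ((sz (g e) + sz e) * 30 + T e))); split.
  apply: PB_add; first exact: PB_mul (PB_sz) (PB_const _).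
  apply: PB_add => //; apply: PB_add => //.
  exact: PB_mul (PB_add Hg (PB_sz)) (PB_const _).
move=> e a B' C D; apply: within_seq; first exact: dupP.
apply: within_seq; first exact: K.
by apply: within_seq; [apply: swapP | apply: H].
Qed.

Lemma PT_pair (A B : Type) (cA : coded A) (cB : coded B) (f : E -> A) (g : E -> B) :
  PT f -> PT g -> PT (fun e => (f e, g e)).
Proof.
move=> Hf Hg; have [c [T [HT H]]] := bothP Hf Hg.
split; last first.
  apply: PB_le (PB_add (PB_add Hf.2 Hg.2) (PB_const 1)) _ => e.
  by rewrite sz_pair addn1.
exists (Seq c (Op (Push r0 true))), (fun e => T e + 1); split.
  exact: PB_add HT (PB_const _).
move=> e a B' C D; apply: within_seq (H _ _ _ _ _) _.
apply: withinE (within_op _ _) _.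
by rewrite /= /enc /= -catA.
Qed.

Lemma PT_fst (A B : Type) (cA : coded A) (cB : coded B) (f : E -> A * B) :
  PT f -> PT (fun e => (f e).1).
Proof.
move=> Hf; apply: PT_comp Hf; split; last first.
  apply: PB_le (PB_sz) _ => -[x y]; rewrite sz_pair /=; lia.
exists (Seq (Op (Pop r0)) (Seq swap drop_tree)), (fun e => sz e * 100); split.
  exact: PB_mul (PB_sz) (PB_const _).
move=> [x y] a B' C D; eapply within_le.
  apply: within_seq; first exact: within_op.
  rewrite /do_op /update /= -catA.
  by apply: within_seq; [apply: swapP | apply: drop_treeP].
have := sz_gt0 x; have := sz_gt0 y.
by rewrite sz_pair /sz /enc; lia.
Qed.

Lemma PT_snd (A B : Type) (cA : coded A) (cB : coded B) (f : E -> A * B) :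
  PT f -> PT (fun e => (f e).2).
Proof.
move=> Hf; apply: PT_comp Hf; split; last first.
  apply: PB_le (PB_sz) _ => -[x y]; rewrite sz_pair /=; lia.
exists (Seq (Op (Pop r0)) drop_tree), (fun e => sz e * 100); split.
  exact: PB_mul (PB_sz) (PB_const _).
move=> [x y] a B' C D; eapply within_le.
  apply: within_seq; first exact: within_op.
  rewrite /do_op /update /= -catA.
  exact: drop_treeP.
have := sz_gt0 x; have := sz_gt0 y.
by rewrite sz_pair /sz /enc; lia.
Qed.

(* All the case analyses reduce to that of a list: constructors are coded by
   leaves and nodes. *)
Lemma PT_seq_case (A B : Type) (cA : coded A) (cB : coded B)
    (l : E -> seq A) (f : E -> B) (g : E * (A * seq A) -> B) :
  PT l -> PT f -> PT g ->
  PT (fun e => if l e is x :: s then g (e, (x, s)) else f e).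
Proof.
move=> Hl Hf Hg; have [c [T [HT H]]] := bothP Hl PT_id.
case: (Hf) (Hg) => [[d [U [HU K]]] Hf2] [[h [V [HV L]]] Hg2].
split; last first.
  apply: PB_le (PB_add Hf2 (PB_seq_case (PT_size Hl) Hg2)) _ => e.
  by case: (l e) => [|x s]; rewrite ?leq_addr ?leq_addl.
pose pack := Seq (Op (Push r0 true)) (Seq swap (Op (Push r0 true))).
exists (Seq c (Case r0 (Seq pack h) d d)), (fun e =>
  T e + (100 * sz (l e) + 100 * sz e + U e +
    (if l e is x :: s then V (e, (x, s)) else 0)).+1); split.
  apply: PB_add => //; apply: PB_S; apply: PB_add; last exact: PB_seq_case Hl.2 HV.
  by do 2?apply: PB_add => //; apply: PB_mul; rewrite ?PB_const ?PB_sz ?Hl.2;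
    (exact: PB_const || exact: PB_sz || exact: Hl.2).
move=> e a B' C D; apply: within_seq (H _ _ _ _ _) _; apply: within_case.
case: (l e) => [|x s]; rewrite /top /do_op /update /=.
  by apply: within_le (K _ _ _ _ _) _; lia.
eapply within_le.
  apply: within_seq; last exact: L.
  apply: within_seq; first exact: within_op.
  rewrite /do_op /update /=.
  apply: within_seq; first exact: (@swapP (Node (tree_of x) (tree_of s)) (tree_of e)).
  by eapply withinE; [exact: within_op | rewrite /= /enc /= -!catA /= -!catA].
have -> : size (ser (Node (tree_of x) (tree_of s))) = (sz x + sz s).+1 by exact: sz_pair.
have Ee : size (ser (tree_of e)) = sz e by [].
by rewrite sz_cons Ee; have := sz_gt0 e; lia.
Qed.

Lemma PT_recode (A B : Type) (cA : coded A) (cB : coded B) (f : E -> A) (g : E -> B) :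
  PT f -> (forall e, tree_of (f e) = tree_of (g e)) -> PT g.
Proof.
move=> Hf H; have Ee e : enc (g e) = enc (f e) by rewrite /enc H.
case: Hf => [[c [T [HT K]]] [k Hk]]; split; last first.
  by exists k => e; rewrite /sz Ee; apply: Hk.
by exists c, T; split=> // *; rewrite Ee; apply: K.
Qed.

(** The bound [M] on all iterates has to be assumed: a polynomial-time [f] may square the size of
    its argument. *)
Lemma PT_iter_seq (A B : Type) (cA : coded A) (cB : coded B)
    (l : E -> seq A) (x : E -> B) (f : B -> B) (M : E -> nat) :
  PT l -> PT x -> PT f -> PB M ->
  (forall e i, i <= size (l e) -> sz (iter i f (x e)) <= M e) ->
  PT (fun e => iter (size (l e)) f (x e)).
Proof.
move=> Hl Hx [[d [U [[k HU] K]]] _] HM HI.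
have [c [T [HT H]]] := bothP Hl Hx.
split; last by apply: PB_le HM _ => e; apply: HI.
(* The linear terms pay for dropping and swapping, the power for [f] on an iterate of size at most
   [M e]. *)
pose V e := 200 * @sz _ (coded_seq cA) (l e) + 200 * M e + (M e + 2) ^ k.
exists (Seq c (iter_loop d)), (fun e => T e + (sz (l e) * V e + 1)); split.
  apply: PB_add => //; apply: PB_add (PB_const 1); apply: PB_mul Hl.2 _.
  apply: PB_add; last exact: PB_exp (PB_add HM (PB_const 2)).
  by apply: PB_add; apply: PB_mul; rewrite // ?Hl.2; exact: PB_const || exact: Hl.2.
move=> e a B' C D; apply: within_seq (H _ _ _ _ _) _ => {c T HT H}.
eapply within_le.
  apply: (@iter_loopP _ _ _ _ f d U K _ _ _ _ _ _ (sz (l e)) (M e) ((M e + 2) ^ k)) => //.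
    exact: HI.
  move=> i lti.
  apply: leq_trans (HU _) _.
  by case: (k) => // k'; rewrite leq_exp2r // leq_add2r HI // ltnW.
by rewrite leq_add2r leq_mul2r ltnW ?orbT // size_sz.
Qed.

End Combinators.

Arguments PT_id {E cE}.
Arguments PT_const {E cE A cA} x.

(** * Functions on numbers and sequences *)

Lemma sz_cat (A : Type) {cA : coded A} (s t : seq A) : (sz (s ++ t)).+1 = sz s + sz t.
Proof. by elim: s => //= x s IH; rewrite !sz_cons; lia. Qed.

Section Cases.
Variables (E : Type) (cE : coded E) (A B : Type) (cA : coded A) (cB : coded B).

Lemma PT_cons (f : E -> A) (g : E -> seq A) :
  PT f -> PT g -> PT (fun e => f e :: g e).
Proof. by move=> Hf Hg; apply: PT_recode (PT_pair Hf Hg) _. Qed.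

Lemma PT_some (f : E -> A) : PT f -> PT (fun e => Some (f e)).
Proof. by move=> Hf; apply: PT_recode (PT_pair Hf (PT_const false)) _. Qed.

Lemma PT_succ (f : E -> nat) : PT f -> PT (fun e => (f e).+1).
Proof. by move=> Hf; apply: PT_recode (PT_pair (PT_const tt) Hf) _. Qed.

Lemma PT_match_seq (l : E -> seq A) (f : E -> B) (g : E -> A -> seq A -> B) :
  PT l -> PT f -> PT (fun p : E * (A * seq A) => g p.1 p.2.1 p.2.2) ->
  PT (fun e => if l e is x :: s then g e x s else f e).
Proof. exact: PT_seq_case. Qed.

Lemma PT_match_option (o : E -> option A) (f : E -> B) (g : E -> A -> B) :
  PT o -> PT f -> PT (fun p : E * A => g p.1 p.2) ->
  PT (fun e => if o e is Some x then g e x else f e).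
Proof.
move=> Ho Hf Hg.
have Hl : PT (fun e => seq_of_opt (o e)).
  by apply: PT_recode Ho _ => e; case: (o e).
have Hg' : PT (fun p : E * (A * seq A) => g p.1 p.2.1).
  apply: (PT_comp Hg (g := fun p => (p.1, p.2.1))).
  by apply: PT_pair; do ?[apply: PT_fst | apply: PT_snd]; apply: PT_id.
apply: PT_ext (PT_seq_case Hl Hf Hg') _ => e.
by case: (o e).
Qed.

Lemma PT_if (b : E -> bool) (f g : E -> A) :
  PT b -> PT f -> PT g -> PT (fun e => if b e then f e else g e).
Proof.
move=> Hb Hf Hg.
have Hl : PT (fun e => nseq (b e) tt) by apply: PT_recode Hb _ => e; case: (b e).
have Hf' : PT (fun p : E * (unit * seq unit) => f p.1).
  by apply: (PT_comp Hf (g := fst)); apply: PT_fst; apply: PT_id.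
apply: PT_ext (PT_seq_case Hl Hg Hf') _ => e.
by case: (b e).
Qed.

Lemma tree_of_nseq n : tree_of (nseq n tt) = tree_of n.
Proof. by elim: n => //= n IH; congr Node. Qed.

Lemma PT_match_nat (n : E -> nat) (f : E -> A) (g : E -> nat -> A) :
  PT n -> PT f -> PT (fun p : E * nat => g p.1 p.2) ->
  PT (fun e => if n e is m.+1 then g e m else f e).
Proof.
move=> Hn Hf Hg.
have Hl : PT (fun e => nseq (n e) tt) by apply: PT_recode Hn _ => e; rewrite tree_of_nseq.
have Hs : PT (fun s : seq unit => size s).
  apply: PT_recode (PT_id) _ => s; rewrite -tree_of_nseq; congr tree_of.
  by elim: s => //= -[] s <-.
have Hg' : PT (fun p : E * (unit * seq unit) => g p.1 (size p.2.2)).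
  apply: (PT_comp Hg (g := fun p => (p.1, size p.2.2))); apply: PT_pair.
    by apply: PT_fst; apply: PT_id.
  by apply: (PT_comp Hs (g := fun p => p.2.2)); do 2 apply: PT_snd; apply: PT_id.
apply: PT_ext (PT_seq_case Hl Hf Hg') _ => e.
by case: (n e) => //= m; rewrite size_nseq.
Qed.

End Cases.

(* [pt] follows the syntax of the function; [pt_lib] and the tactics that it calls
   are extended as functions are shown to be polynomial-time. *)
Ltac pt_lib := fail.

Ltac pt1 := cbv beta;
  lazymatch goal with
  | |- PT (fun e => e) => exact: PT_id
  | |- PT (fun _ => ?c) => exact: (PT_const c)
  | |- PT (fun e => (_, _)) => apply: PT_pair
  | |- PT (fun e => (_).1) => apply: PT_fst
  | |- PT (fun e => (_).2) => apply: PT_snd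
  | |- PT (fun e => _ :: _) => apply: PT_cons
  | |- PT (fun e => Some _) => apply: PT_some
  | |- PT (fun e => S _) => apply: PT_succ
  | |- PT (fun e => match @?b e with _ => _ end) =>
      first [ apply: PT_if | apply: PT_match_seq | apply: PT_match_option
            | apply: PT_match_nat ]
  | |- PT (fun e => _) => first
    [ multimatch goal with
      | H : PT ?f |- PT (fun e => ?f (@?a e)) => refine (PT_comp (g := a) H _)
      | H : PT (fun p => ?f p.1 p.2) |- PT (fun e => ?f (@?a e) (@?b e)) =>
          refine (PT_comp (g := fun e => (a e, b e)) H _)
      | H : PT (fun p => ?f p.1.1 p.1.2 p.2) |- PT (fun e => ?f (@?a e) (@?b e) (@?c e)) =>
          refine (PT_comp (g := fun e => (a e, b e, c e)) H _)
      end
    | pt_lib ]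
  | |- @PT ?E ?A ?cE ?cA ?f => change (@PT E A cE cA (fun e => f e))
  end.

Ltac pt := repeat first [ assumption | pt1 ].

Ltac pb := repeat first
  [ exact: PB_const | exact: PB_sz | assumption
  | apply: PB_add | apply: PB_mul | apply: PB_exp | apply: PB_S | apply: PT_size ].

(** * Folds and iterations of bounded growth *)

Section Fold.
Variables (E : Type) (cE : coded E) (A X : Type) (cA : coded A) (cX : coded X).
Variables (l : E -> seq X) (a : E -> A) (f : E -> A -> X -> A).
Hypotheses (Hl : PT l) (Ha : PT a) (Hf : PT (fun p : E * A * X => f p.1.1 p.1.2 p.2)).

(** A fold is an iteration on triples of environment, remaining list and accumulator, with the list
    as clock. The environment travels in the state because the iterated function must be closed. *)
Lemma PT_foldl_bounded (M : E -> nat) : PB M ->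
  (forall e s1 s2, l e = s1 ++ s2 -> sz (foldl (f e) (a e) s1) <= M e) ->
  PT (fun e => foldl (f e) (a e) (l e)).
Proof.
move=> HM Hbound.
pose step (p : E * (seq X * A)) :=
  if p.2.1 is x :: s then (p.1, (s, f p.1 p.2.2 x)) else p.
have Hstep : PT step.
  apply: (PT_match_seq (g := fun p x s => (p.1, (s, f p.1 p.2.2 x)))).
  - by apply: PT_fst; apply: PT_snd; apply: PT_id.
  - exact: PT_id.
  - apply: PT_pair; first by do 2!apply: PT_fst; apply: PT_id.
    apply: PT_pair; first by do 2!apply: PT_snd; apply: PT_id.
    apply: (PT_comp Hf (g := fun p => (p.1.1, p.1.2.2, p.2.1))).
    by pt.
have iterE e i : iter i step (e, (l e, a e)) =
    (e, (drop i (l e), foldl (f e) (a e) (take i (l e)))).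
  elim: i => [|i IH]; first by rewrite drop0 take0.
  rewrite iterS IH /step /=; case: (ltnP i (size (l e))) => lti.
    have [x0 _] : exists x0 : X, True by case: (l e) lti => // x; exists x.
    rewrite (drop_nth x0 lti) (take_nth x0 lti).
    by rewrite -cats1 foldl_cat.
  by rewrite !drop_oversize ?take_oversize // leqW.
pose (N := fun e : E => sz e + (sz (l e) + M e + 2)).
have H := PT_iter_seq Hl (PT_pair PT_id (PT_pair Hl Ha)) Hstep (M := N).
apply: PT_ext (PT_snd (PT_snd (H _ _))) _ => [|e i _|e].
- apply: PB_add (PB_sz) _; apply: PB_add (PB_const 2).
  by apply: PB_add => //; apply: PT_size.
- rewrite iterE !sz_pair /N.
  have H1 := Hbound e _ _ (esym (cat_take_drop i (l e))).
  have H2 : sz (drop i (l e)) <= sz (l e).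
    elim: (l e) (i) => [|x s IH] [|j] //=; rewrite sz_cons.
    by apply: leq_trans (IH j) _; lia.
  by lia.
- by rewrite iterE /= take_size.
Qed.

(** The increment [B e x] does not depend on the accumulator, so growth is at most the length of the
    list times a polynomial. *)
Lemma PT_foldl (B : E -> X -> nat) : PB (fun p : E * X => B p.1 p.2) ->
  (forall e b x, sz (f e b x) <= sz b + B e x) ->
  PT (fun e => foldl (f e) (a e) (l e)).
Proof.
move=> [k Hk] Hstep.
apply: (@PT_foldl_bounded (fun e => sz (a e) + sz (l e) * (sz e + sz (l e) + 2) ^ k)).
  apply: PB_add; first exact: PT_size.
  apply: PB_mul; first exact: PT_size.
  apply: PB_exp; apply: PB_add (PB_const 2); apply: PB_add (PB_sz) _; exact: PT_size.
move=> e s1 s2 El.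
set N := (_ + 2) ^ k.
have Hx x : sz x < sz (l e) -> B e x <= N.
  move=> lex; apply: leq_trans (Hk (e, x)) _; rewrite sz_pair /N.
  by case: (k) => // k'; rewrite leq_exp2r //; lia.
have H : sz (foldl (f e) (a e) s1) <= sz (a e) + size s1 * N; last first.
  apply: leq_trans H _; rewrite leq_add2l leq_mul2r.
  have := @size_sz _ cX (l e); rewrite El size_cat => H; apply/orP; right.
  by apply: leq_trans _ (ltnW H); rewrite leq_addr.
elim/last_ind: s1 s2 El => [|s1 x IH] s2 El /=; first by rewrite leq_addr.
rewrite -cats1 foldl_cat size_cat mulnDl mul1n addnA /=.
apply: leq_trans (Hstep _ _ _) _; apply: leq_add.
  by apply: (IH (x :: s2)); rewrite El -cats1 -catA.
apply: Hx; have := @sz_cat _ cX (rcons s1 x) s2; have := @sz_cat _ cX s1 [:: x].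
by rewrite El cats1 sz_cons sz_nil; have := @sz_gt0 _ (coded_seq cX) s1; have := @sz_gt0 _ (coded_seq cX) s2; lia.
Qed.

End Fold.

Lemma PT_andb (E : Type) (cE : coded E) (a b : E -> bool) : PT a -> PT b -> PT (fun e => a e && b e).
Proof. by move=> Ha Hb; exact: (PT_if Ha Hb (PT_const false)). Qed.

Lemma PT_orb (E : Type) (cE : coded E) (a b : E -> bool) : PT a -> PT b -> PT (fun e => a e || b e).
Proof. by move=> Ha Hb; exact: (PT_if Ha (PT_const true) Hb). Qed.

Lemma PT_negb (E : Type) (cE : coded E) (b : E -> bool) : PT b -> PT (fun e => ~~ b e).
Proof. by move=> Hb; exact: (PT_if Hb (PT_const false) (PT_const true)). Qed.

Lemma foldl_iter (A X : Type) (f : A -> A) (a : A) (s : seq X) :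
  foldl (fun b _ => f b) a s = iter (size s) f a.
Proof. by elim: s a => //= x s IH a; rewrite IH -iterSr. Qed.

Lemma PT_iter (E : Type) (cE : coded E) (A : Type) (cA : coded A) (n : E -> nat) (f : E -> A -> A)
    (a : E -> A) (B : E -> nat) :
  PB B -> (forall e b, sz (f e b) <= sz b + B e) ->
  PT n -> PT a -> PT (fun p : E * A => f p.1 p.2) ->
  PT (fun e => iter (n e) (f e) (a e)).
Proof.
move=> HB Hstep Hn Ha Hf.
have Hl : PT (fun e => nseq (n e) tt).
  by apply: PT_recode Hn _ => e; rewrite tree_of_nseq.
apply: PT_ext (PT_foldl (f := fun e b _ => f e b) (B := fun e _ => B e) Hl Ha _ _ _) _.
- by pt.
- by apply: (@PB_comp _ _ _ _ fst) HB; pb; pt.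
- by move=> e b _; apply: Hstep.
- by move=> e; rewrite foldl_iter size_nseq.
Qed.

Lemma PT_addn (E : Type) (cE : coded E) (m n : E -> nat) : PT m -> PT n -> PT (fun e => m e + n e).
Proof.
move=> Hm Hn; apply: PT_ext (PT_iter (f := fun _ => S) (PB_const 2) _ Hm Hn _) _.
- by move=> e b; rewrite !sz_nat; lia.
- by pt.
- by move=> e; rewrite iter_succn addnC.
Qed.

Lemma PT_predn (E : Type) (cE : coded E) (n : E -> nat) : PT n -> PT (fun e => (n e).-1).
Proof.
move=> Hn; apply: PT_ext (PT_match_nat (g := fun _ k => k) Hn (PT_const 0) _) _.
  by pt.
by move=> e; case: (n e).
Qed.

Lemma PT_subn (E : Type) (cE : coded E) (m n : E -> nat) : PT m -> PT n -> PT (fun e => m e - n e).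
Proof.
move=> Hm Hn; apply: PT_ext (PT_iter (f := fun _ => predn) (PB_const 2) _ Hn Hm _) _.
- by move=> e b; rewrite !sz_nat; lia.
- by apply: PT_predn; pt.
- by move=> e; elim: (n e) => [|k IH]; rewrite ?subn0 ?subnS //= IH.
Qed.

Lemma PT_muln (E : Type) (cE : coded E) (m n : E -> nat) : PT m -> PT n -> PT (fun e => m e * n e).
Proof.
move=> Hm Hn.
apply: PT_ext (PT_iter (f := fun e => addn (n e)) (B := fun e => 2 * sz (n e)) _ _ Hm (PT_const 0) _) _.
- by pb.
- by move=> e b; rewrite !sz_nat; lia.
- by apply: PT_addn; pt.
- by move=> e; elim: (m e) => //= k ->; rewrite mulSn.
Qed.

Lemma PT_eqn0 (E : Type) (cE : coded E) (n : E -> nat) : PT n -> PT (fun e => n e == 0).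
Proof.
move=> Hn; apply: (PT_ext (f := fun e => if n e is _.+1 then false else true)); first by pt.
by move=> e; case: (n e).
Qed.

Lemma PT_leq (E : Type) (cE : coded E) (m n : E -> nat) : PT m -> PT n -> PT (fun e => m e <= n e).
Proof. by move=> Hm Hn; apply: PT_eqn0; apply: PT_subn. Qed.

Lemma PT_eqn (E : Type) (cE : coded E) (m n : E -> nat) : PT m -> PT n -> PT (fun e => m e == n e).
Proof.
move=> Hm Hn; apply: PT_ext (PT_andb (PT_leq Hm Hn) (PT_leq Hn Hm)) _ => e.
by rewrite eqn_leq.
Qed.

Lemma PT_eqb (E : Type) (cE : coded E) (a b : E -> bool) : PT a -> PT b -> PT (fun e => a e == b e).
Proof.
move=> Ha Hb; apply: (PT_ext (f := fun e => if a e then b e else ~~ b e)).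
  by pt; apply: PT_negb.
by move=> e; case: (a e) (b e) => [] [].
Qed.

Lemma PT_nseq (E : Type) (cE : coded E) (n : E -> nat) : PT n -> forall (A : Type) (cA : coded A) (x : E -> A), PT x ->
  PT (fun e => nseq (n e) (x e)).
Proof.
move=> Hn A cA x Hx.
apply: PT_ext (PT_iter (f := fun e => cons (x e)) (B := fun e => (sz (x e)).+1) _ _ Hn (PT_const [::]) _) _.
- by pb.
- by move=> e b; rewrite sz_cons; lia.
- by pt.
- by move=> e; elim: (n e) => //= k <-.
Qed.

Ltac pt_seq := fail.

Ltac pt_lib ::=
  lazymatch goal with
  | |- PT (fun e => andb _ _) => apply: PT_andb
  | |- PT (fun e => orb _ _) => apply: PT_orb
  | |- PT (fun e => negb _) => apply: PT_negb
  | |- PT (fun e => addn _ _) => apply: PT_addn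
  | |- PT (fun e => subn _ _) => apply: PT_subn
  | |- PT (fun e => muln _ _) => apply: PT_muln
  | |- PT (fun e => leq _ _) => apply: PT_leq
  | |- PT (fun e => _ == _) => first [ apply: PT_eqn | apply: PT_eqb | pt_seq ]
  | |- PT (fun e => nseq _ _) => apply: PT_nseq
  | |- PT (fun e => predn _) => apply: PT_predn
  | |- _ => pt_seq
  end.

Lemma foldl_cons_rev (A : Type) (s t : seq A) :
  foldl (fun u x => x :: u) t s = rev s ++ t.
Proof. by elim: s t => //= x s IH t; rewrite IH rev_cons -cats1 -catA. Qed.

Section Seq.
Variables (E : Type) (cE : coded E) (A B : Type) (cA : coded A) (cB : coded B).
Variable l : E -> seq A.
Hypothesis Hl : PT l.

Lemma PT_rev : PT (fun e => rev (l e)).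
Proof.
apply: PT_ext (PT_foldl (f := fun _ s x => x :: s) (B := fun _ x => (@sz _ cA x).+1) Hl
  (PT_const [::]) _ _ _) _.
- by pt.
- by pb; pt.
- by move=> _ b x; rewrite sz_cons; lia.
- by move=> e; rewrite foldl_cons_rev cats0.
Qed.

Lemma PT_length : PT (fun e => size (l e)).
Proof.
apply: PT_ext (PT_foldl (f := fun _ k _ => k.+1) (B := fun _ _ => 2) Hl (PT_const 0) _ _ _) _.
- by pt.
- by pb.
- by move=> _ b x; rewrite !sz_nat; lia.
- by move=> e; rewrite foldl_iter; elim: (size _) => //= n ->.
Qed.

Lemma PT_behead : PT (fun e => behead (l e)).
Proof. by apply: (PT_match_seq (g := fun _ _ s => s)); pt. Qed.

Lemma PT_head (d : A) : PT (fun e => head d (l e)).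
Proof. by apply: (PT_match_seq (g := fun _ x _ => x)); pt. Qed.

Lemma PT_all (p : E -> A -> bool) : PT (fun q : E * A => p q.1 q.2) ->
  PT (fun e => all (p e) (l e)).
Proof.
move=> Hp; have Hb (b : bool) : sz b <= 3 by case: b.
apply: PT_ext (PT_foldl (f := fun e b x => b && p e x) (B := fun _ _ => 3) Hl (PT_const true) _ _ _) _.
- by pt.
- by pb.
- by move=> e b x; apply: leq_trans (Hb _) _; rewrite leq_addl.
- move=> e; rewrite -[RHS]andTb; elim: (l e) true => [|x s IH] b /=; first by rewrite andbT.
  by rewrite IH andbA.
Qed.

Lemma sz_behead (s : seq A) : sz (behead s) <= sz s.
Proof. by case: s => // x s; rewrite sz_cons /=; lia. Qed.

End Seq.

Lemma PT_cat (E A : Type) (cE : coded E) (cA : coded A) (s t : E -> seq A) :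
  PT s -> PT t -> PT (fun e => s e ++ t e).
Proof.
move=> Hs Ht.
apply: PT_ext (PT_foldl (f := fun _ s x => x :: s) (B := fun _ x => (@sz _ cA x).+1)
  (PT_rev Hs) Ht _ _ _) _.
- by pt.
- by pb; pt.
- by move=> _ b x; rewrite sz_cons; lia.
- by move=> e; rewrite foldl_cons_rev revK.
Qed.

Lemma PT_rcons (E A : Type) (cE : coded E) (cA : coded A) (s : E -> seq A) (x : E -> A) :
  PT s -> PT x -> PT (fun e => rcons (s e) (x e)).
Proof.
move=> Hs Hx; apply: PT_ext (PT_cat Hs (PT_cons Hx (PT_const [::]))) _ => e.
by rewrite cats1.
Qed.

Lemma PT_map (E A B : Type) (cE : coded E) (cA : coded A) (cB : coded B)
    (l : E -> seq A) (f : E -> A -> B) :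
  PT l -> PT (fun p : E * A => f p.1 p.2) -> PT (fun e => map (f e) (l e)).
Proof.
move=> Hl Hf.
(* The fold conses in front, so it runs over the reversed list. *)
apply: PT_ext (PT_foldl (f := fun e s x => f e x :: s) (B := fun e x => (@sz _ cB (f e x)).+1)
  (PT_rev Hl) (PT_const [::]) _ _ _) _.
- by pt.
- by pb.
- by move=> e b x; rewrite sz_cons; lia.
- move=> e; rewrite -[RHS]cats0 foldl_rev.
  by elim: (l e) => //= x s ->.
Qed.

Lemma PT_flatten (E A : Type) (cE : coded E) (cA : coded A) (l : E -> seq (seq A)) :
  PT l -> PT (fun e => flatten (l e)).
Proof.
move=> Hl.
apply: PT_ext (PT_foldl (f := fun _ s t => s ++ t) (B := fun _ x => @sz _ (coded_seq cA) x)
  Hl (PT_const [::]) _ _ _) _.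
- by apply: PT_cat; pt.
- by pb; pt.
- by move=> _ s t; rewrite -sz_cat.
- move=> e; rewrite -[RHS]cat0s; elim: (l e) [::] => [|t s IH] u /=; first by rewrite cats0.
  by rewrite IH catA.
Qed.

Lemma PT_drop (E A : Type) (cE : coded E) (cA : coded A) (n : E -> nat) (s : E -> seq A) :
  PT n -> PT s -> PT (fun e => drop (n e) (s e)).
Proof.
move=> Hn Hs.
apply: PT_ext (PT_iter (f := fun _ => behead) (PB_const 0) _ Hn Hs _) _.
- by move=> _ b; rewrite addn0 sz_behead.
- by apply: PT_behead; pt.
- by move=> e; elim: (n e) => [|k IH] /=; rewrite ?drop0 // IH -drop1 drop_drop.
Qed.

Lemma PT_take (E A : Type) (cE : coded E) (cA : coded A) (n : E -> nat) (s : E -> seq A) :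
  PT n -> PT s -> PT (fun e => take (n e) (s e)).
Proof.
move=> Hn Hs.
have H := PT_rev (PT_drop (PT_subn (PT_length Hs) Hn) (PT_rev Hs)).
apply: PT_ext H _ => e; rewrite drop_rev revK.
case: (leqP (n e) (size (s e))) => [le|lt]; first by rewrite subKn.
have -> : size (s e) - n e = 0 by apply/eqP; rewrite subn_eq0 ltnW.
by rewrite subn0 take_size take_oversize // ltnW.
Qed.

Lemma PT_nth (E A : Type) (cE : coded E) (cA : coded A) (d : A) (n : E -> nat)
    (s : E -> seq A) :
  PT s -> PT n -> PT (fun e => nth d (s e) (n e)).
Proof.
move=> Hs Hn; apply: PT_ext (PT_head (PT_drop Hn Hs) d) _ => e.
by rewrite -nth0 nth_drop addn0.
Qed.

Lemma PT_iota (E : Type) (cE : coded E) (m n : E -> nat) :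
  PT m -> PT n -> PT (fun e => iota (m e) (n e)).
Proof.
move=> Hm Hn.
(* The list is built from its end: after [k] steps it is [iota (n e - k) k]. *)
pose f (e : E) (s : seq nat) := n e - (size s).+1 :: s.
have H : PT (fun e => iter (n e) (f e) [::]).
  apply: (PT_iter (B := fun e => @sz _ coded_nat (n e) + 1) _ _ Hn (PT_const [::])).
  - by pb.
  - by move=> e b; rewrite sz_cons !sz_nat; lia.
  - by rewrite /f; pt; eapply PT_length; pt.
apply: PT_ext (PT_map (f := fun e => addn (m e)) H _) _; first by pt.
move=> e; have -> : iter (n e) (f e) [::] = iota 0 (n e).
  have Hi k : k <= n e -> iter k (f e) [::] = iota (n e - k) k.
    elim: k => // k IH lek; rewrite iterS IH 1?ltnW // {1}/f size_iota /=.
    by congr (_ :: iota _ _); lia.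
  by rewrite Hi // subnn.
by rewrite -iotaDl addn0.
Qed.

Lemma PT_eqbits (E : Type) (cE : coded E) (s t : E -> bits) :
  PT s -> PT t -> PT (fun e => s e == t e).
Proof.
move=> Hs Ht.
have Hi : PT (fun e => iota 0 (size (s e))) by apply: PT_iota; pt; apply: PT_length.
have H : PT (fun p : E * nat => nth false (s p.1) p.2 == nth false (t p.1) p.2).
  by pt; eapply PT_nth; pt.
apply: PT_ext (PT_andb (PT_eqn (PT_length Hs) (PT_length Ht))
  (PT_all (p := fun e i => nth false (s e) i == nth false (t e) i) Hi H)) _ => e.
apply/andP/eqP => [[/eqP Es /allP H1]|->]; last first.
  by split=> //; apply/allP.
apply: (eq_from_nth (x0 := false) Es) => i lti.
by apply/eqP/H1; rewrite mem_iota.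
Qed.

Ltac pt_extra := fail.

Ltac pt_seq ::=
  lazymatch goal with
  | |- PT (fun e => _ == _) => apply: PT_eqbits
  | |- PT (fun e => rev _) => apply: PT_rev
  | |- PT (fun e => size _) => eapply PT_length
  | |- PT (fun e => behead _) => apply: PT_behead
  | |- PT (fun e => cat _ _) => apply: PT_cat
  | |- PT (fun e => rcons _ _) => apply: PT_rcons
  | |- PT (fun e => map _ _) => eapply PT_map
  | |- PT (fun e => flatten _) => apply: PT_flatten
  | |- PT (fun e => drop _ _) => apply: PT_drop
  | |- PT (fun e => take _ _) => apply: PT_take
  | |- PT (fun e => nth _ _ _) => apply: PT_nth
  | |- PT (fun e => iota _ _) => apply: PT_iota
  | |- _ => pt_extra
  end.

(** * Parsing, evaluation and descents *)

Definition parse_nat (x : bits) : option (nat * bits) :=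
  if index false x < size x then Some (index false x, drop (index false x).+1 x)
  else None.

Definition parse_gate (x : bits) : option (gate * bits) :=
  match x with
  | [::] => None
  | a :: x1 =>
    if a then
      match x1 with
      | [::] => None
      | b :: x2 =>
        if parse_nat x2 is Some p then
          if parse_nat p.2 is Some q then
            Some (if b then Or p.1 q.1 else And p.1 q.1, q.2)
          else None
        else None
      end
    else if parse_nat x1 is Some p then Some (Not p.1, p.2) else None
  end.

Section ParseSeq.
Variables (T : Type) (parse : bits -> option (T * bits)) (c : T -> bits).

(* The flag is [true] as long as the end of the sequence has not been read; a
   parse error empties the input, so that the flag remains [true]. *)
Definition parse_step (st : seq T * bits * bool) : seq T * bits * bool :=
  if st.2 then
    match st.1.2 with
    | [::] => st
    | b :: r =>
      if b then
        if parse r is Some q then (q.1 :: st.1.1, q.2, true) else (st.1.1, [::], true)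
      else (st.1.1, r, false)
    end
  else st.

(** One step per bit suffices, since each element consumes at least its leading [true] and the end
    consumes a [false]. *)
Definition parse_run (x : bits) := iter (size x) parse_step ([::], x, true).

Definition parse_seq (x : bits) : option (seq T * bits) :=
  if (parse_run x).2 then None else Some (rev (parse_run x).1.1, (parse_run x).1.2).

Lemma code_seq_cons a s : code_seq c (a :: s) = true :: c a ++ code_seq c s.
Proof. by rewrite /code_seq /= rcons_cat. Qed.

Lemma size_code_seq s : size s < size (code_seq c s).
Proof.
by elim: s => // a s IH; rewrite code_seq_cons /= size_cat ltnS (leq_trans IH) ?leq_addl.
Qed.

Hypothesis parseK : forall a r, parse (c a ++ r) = Some (a, r).
Hypothesis parse_sound : forall x a r, parse x = Some (a, r) -> x = c a ++ r.

Lemma iter_parse_done n acc r :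
  iter n parse_step (acc, r, false) = (acc, r, false).
Proof. by elim: n => //= n ->. Qed.

Lemma iter_parse_code n acc s r : size s < n ->
  iter n parse_step (acc, code_seq c s ++ r, true) = (rev s ++ acc, r, false).
Proof.
elim: s n acc => [|a s IH] [|n] acc // lt; rewrite iterSr.
  by rewrite {2}/parse_step /= iter_parse_done.
rewrite code_seq_cons {2}/parse_step /= -catA parseK IH //.
by rewrite rev_cons -cats1 -catA.
Qed.

Lemma parse_seqK s r : parse_seq (code_seq c s ++ r) = Some (s, r).
Proof.
rewrite /parse_seq /parse_run iter_parse_code /= ?cats0 ?revK //.
by rewrite size_cat (leq_trans (size_code_seq s)) ?leq_addr.
Qed.

Lemma iter_parse_sound n acc x acc' r :
  iter n parse_step (acc, x, true) = (acc', r, false) ->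
  exists2 s, x = code_seq c s ++ r & acc' = rev s ++ acc.
Proof.
elim: n acc x => [|n IH] acc x //; rewrite iterSr {2}/parse_step /=.
case: x => [/IH //|[] x].
  case E: (parse x) => [[a x']|] /= /IH [s Es ->].
    exists (a :: s); last by rewrite rev_cons -cats1 -catA.
    by rewrite (parse_sound E) Es code_seq_cons /= catA.
  (* After a parse error the remaining input is empty, but the code of a sequence never is. *)
  have /(congr1 size)/eqP := Es.
  by rewrite size_cat /= -[_ == _]negbK neq_ltn ltn_addr ?(leq_trans _ (size_code_seq s)).
by rewrite iter_parse_done => -[<- <-]; exists [::].
Qed.

(** Together with [parse_seqK], this makes the parser a decision procedure for being a code, on
    which the two clauses of a search problem depend. *)
Lemma parse_seq_sound x s r : parse_seq x = Some (s, r) -> x = code_seq c s ++ r.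
Proof.
rewrite /parse_seq /parse_run.
case E: (iter _ _ _) => [[acc r'] []] //= [<- <-].
by have [t -> ->] := iter_parse_sound E; rewrite cats0 revK.
Qed.

End ParseSeq.

Lemma parse_natK k r : parse_nat (code_nat k ++ r) = Some (k, r).
Proof.
have Ei : index false (code_nat k ++ r) = k.
  by elim: k => //= k ->.
rewrite /parse_nat Ei size_cat size_rcons size_nseq leq_addr.
by rewrite drop_cat size_rcons size_nseq ltnn subnn drop0.
Qed.

Lemma parse_nat_sound x k r : parse_nat x = Some (k, r) -> x = code_nat k ++ r.
Proof.
rewrite /parse_nat; case: ltnP => // lt [<- <-].
elim: x lt => [|[] x IH] //=; last by rewrite drop0.
by rewrite ltnS => /IH {1}->.
Qed.

Lemma parse_gateK g r : parse_gate (code_gate g ++ r) = Some (g, r).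
Proof. by case: g => [i j|i j|i] /=; rewrite -?catA !parse_natK. Qed.

Lemma parse_gate_sound x g r : parse_gate x = Some (g, r) -> x = code_gate g ++ r.
Proof.
case: x => [|[] x] //=; last first.
  by case E: (parse_nat x) => [[i x']|] //= [<- <-]; rewrite (parse_nat_sound E).
case: x => [|b x] //; case E: (parse_nat x) => [[i x']|] //=.
case E': (parse_nat x') => [[j x'']|] //= [<- <-].
rewrite (parse_nat_sound E) (parse_nat_sound E').
by case: b; rewrite /= -catA.
Qed.

(* The circuits of [Defs] without their dependent types. *)
Definition net := (seq gate * seq nat)%type.

Definition code_net (C : net) : bits :=
  code_seq code_gate C.1 ++ code_seq code_nat C.2.

Definition parse_net (x : bits) : option (net * bits) :=
  if parse_seq parse_gate x is Some p then
    if parse_seq parse_nat p.2 is Some q then Some (p.1, q.1, q.2) else None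
  else None.

Lemma parse_netK C r : parse_net (code_net C ++ r) = Some (C, r).
Proof.
rewrite /parse_net -catA (parse_seqK parse_gateK) /= (parse_seqK parse_natK) /=.
by case: C.
Qed.

Lemma parse_net_sound x C r : parse_net x = Some (C, r) -> x = code_net C ++ r.
Proof.
rewrite /parse_net; case E: (parse_seq _ x) => [[s x']|] //=.
case E': (parse_seq _ x') => [[t x'']|] //= [<- <-].
by rewrite (parse_seq_sound parse_gate_sound E) (parse_seq_sound parse_nat_sound E') -catA.
Qed.

Definition parse_instance (x : bits) : option (nat * (net * net)) :=
  if parse_nat x is Some p then
    if parse_net p.2 is Some q then
      if parse_net q.2 is Some r then
        if [&& size r.2 == 0, size q.1.2 == p.1 & size r.1.2 == p.1]
        then Some (p.1, (q.1, r.1)) else None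
      else None
    else None
  else None.

Definition net_of n m (C : circuit n m) : net := (gates C, tval (outputs C)).

Lemma parse_instanceK n (f g : circuit n n) :
  parse_instance (code_nephew f g) = Some (n, (net_of f, net_of g)).
Proof.
rewrite /parse_instance /code_nephew parse_natK /=.
rewrite -[code_circuit f]/(code_net (net_of f)) -[code_circuit g]/(code_net (net_of g)).
by rewrite parse_netK /= -[code_net (net_of g)]cats0 parse_netK /= !size_tuple eqxx.
Qed.

Lemma parse_instance_sound x n F G : parse_instance x = Some (n, (F, G)) ->
  exists f g : circuit n n, [/\ x = code_nephew f g, F = net_of f & G = net_of g].
Proof.
rewrite /parse_instance; case E: (parse_nat x) => [[k x1]|] //=.
case E1: (parse_net x1) => [[f x2]|] //=.
case E2: (parse_net x2) => [[g x3]|] //=.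
case: ifP => // /and3P[/eqP/size0nil E3 Sf Sg] [Ek Ef Eg]; subst k f g x3.
exists (Circuit n F.1 (Tuple Sf)), (Circuit n G.1 (Tuple Sg)); split.
- rewrite (parse_nat_sound E) (parse_net_sound E1) (parse_net_sound E2) cats0.
  by rewrite /code_nephew.
- by rewrite /net_of /=; case: (F).
- by rewrite /net_of /=; case: (G).
Qed.

Definition run_gates (ws : bits) (gs : seq gate) : bits :=
  foldl (fun ws g => rcons ws (gate_value ws g)) ws gs.

Definition eval_net (C : net) (x : bits) : bits :=
  map (nth false (run_gates x C.1)) C.2.

Lemma eval_netE n m (C : circuit n m) (x : n.-tuple bool) :
  tval (eval C x) = eval_net (net_of C) x.
Proof. by []. Qed.

(** * Descents and their injectivity *)

Section Descent.
Variables F G : bits -> bits.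

Definition is_nephew_solution (u : bits) : bool :=
  (F (F (G u)) != F u) || (F (G u) == u).

Definition descend (u : bits) (b : bool) : bits := G (if b then F (G u) else u).

Definition search_step (st : option bits * bits) (b : bool) : option bits * bits :=
  (if st.1 is Some w then Some w else
   if is_nephew_solution st.2 then Some st.2 else
   if is_nephew_solution (F (G st.2)) then Some (F (G st.2)) else None,
   descend st.2 b).

Definition search (u : bits) (r : bits) : option bits :=
  (foldl search_step (None, u) r).1.

(** The end of the descent is not tested: injectivity only uses the nodes from which a step is made,
    and their siblings. *)
Fixpoint clear_path (u : bits) (r : bits) : bool :=
  if r is b :: r' then
    [&& ~~ is_nephew_solution u, ~~ is_nephew_solution (F (G u)) &
        clear_path (descend u b) r']
  else true.

Lemma search_some w u r : (foldl search_step (Some w, u) r).1 = Some w.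
Proof. by elim: r u => //= b r IH u; rewrite IH. Qed.

Lemma search_clear u r : search u r = None -> clear_path u r.
Proof.
rewrite /search; elim: r u => //= b r IH u; rewrite {2}/search_step /=.
case: is_nephew_solution; first by rewrite search_some.
case: is_nephew_solution; first by rewrite search_some.
by move/IH.
Qed.

Lemma search_sound (n : nat) u r w :
  (forall v, size (F v) = n) -> (forall v, size (G v) = n) -> size u = n ->
  search u r = Some w -> is_nephew_solution w /\ size w = n.
Proof.
move=> HF HG; rewrite /search.
elim: r u => //= b r IH u Hu; rewrite {2}/search_step /=.
case E1: (is_nephew_solution u); first by rewrite search_some => -[<-].
case E2: (is_nephew_solution (F (G u))); first by rewrite search_some => -[<-].
by apply: IH; rewrite /descend HG.
Qed.

(** Whatever the bit, the next node is a grandchild of [F u]. So each step adds one level below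
    [F u], and the extra [F] is there because [u] itself may have been left for its sibling. *)
Lemma descend_ancestor u r : clear_path u r ->
  iter (size r) F (F (foldl descend u r)) = F u.
Proof.
elim: r u => [|b r IH] u //= /and3P[]; rewrite negb_or negbK => /andP[/eqP E _].
rewrite negb_or negbK => /andP[/eqP E' _] /IH.
rewrite -iterS iterSr => /(congr1 F); rewrite -iterS iterSr => -> .
by case: b; rewrite /descend ?E'.
Qed.

Lemma descend_inj u r r' : clear_path u r -> clear_path u r' -> size r = size r' ->
  foldl descend u r = foldl descend u r' -> r = r'.
Proof.
elim: r r' u => [|b r IH] [|b' r'] u // Hr Hr' [Es] El.
move: (Hr) (Hr') => /and3P[N1 N2 Hr1] /and3P[_ _ Hr1'].
have [Eb|Nb] := eqVneq b b'.
  by subst b'; congr cons; apply: IH Hr1 Hr1' Es El.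
have := descend_ancestor Hr1'; rewrite -[foldl _ _ _]El -Es descend_ancestor // => E.
(* The ancestors at this level are [F (G u)] and [F (G (F (G u)))]; their equality would make
   [F (G u)] a solution. *)
case/norP: N2 => _ /eqP []; move: E; rewrite /descend.
move: N1; rewrite negb_or negbK => /andP[/eqP E1 /eqP E2].
by case: b b' Nb {Hr Hr' Hr1 Hr1' El} => [] [].
Qed.

End Descent.

(** * The circuit of a descent *)

Lemma run_gates_cat ws s t : run_gates ws (s ++ t) = run_gates (run_gates ws s) t.
Proof. exact: foldl_cat. Qed.

(* When a net whose inputs are the wires [U] is inserted after [W] wires, its
   gates drive the wires [W], [W + 1], ... *)
Definition rewire (U : seq nat) (W i : nat) : nat :=
  if i < size U then nth 0 U i else W + (i - size U).

Definition rewire_gate (U : seq nat) (W : nat) (g : gate) : gate :=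
  match g with
  | And i j => And (rewire U W i) (rewire U W j)
  | Or i j => Or (rewire U W i) (rewire U W j)
  | Not i => Not (rewire U W i)
  end.

(* Wire [z] carries the constant false, the value of the missing wires; later
   gates would give a value to the other candidates. *)
Definition net_outputs (z : nat) (U : seq nat) (W : nat) (C : net) : seq nat :=
  map (fun i => if i < size U + size C.1 then rewire U W i else z) C.2.

Definition values (ws : bits) (U : seq nat) : bits := map (nth false ws) U.

Lemma values_cat ws d U : all (fun k => k < size ws) U ->
  values (ws ++ d) U = values ws U.
Proof. by move=> /allP H; apply/eq_in_map => k /H; rewrite nth_cat => ->. Qed.

Section Insert.
Variables (ws : bits) (U : seq nat).
Hypothesis HU : all (fun k => k < size ws) U.

(** Holds for every [i]: a wire that is not driven yet is missing on both sides and reads as false.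
    Forward references of gates therefore keep their meaning. *)
Lemma nth_rewire d i : nth false (ws ++ d) (rewire U (size ws) i) =
  nth false (values ws U ++ d) i.
Proof.
rewrite /rewire nth_cat [RHS]nth_cat size_map; case: (ltnP i (size U)) => lti.
  by have /= -> := allP HU _ (mem_nth 0 lti); rewrite /values (nth_map 0).
by rewrite ltnNge leq_addr /= addKn.
Qed.

Lemma run_rewired gs : exists d, [/\ run_gates (values ws U) gs = values ws U ++ d,
  run_gates ws (map (rewire_gate U (size ws)) gs) = ws ++ d & size d = size gs].
Proof.
elim/last_ind: gs => [|gs g [d [Ed Ed' Sd]]]; first by exists [::]; rewrite !cats0.
exists (rcons d (gate_value (values ws U ++ d) g)); rewrite !size_rcons Sd.
rewrite map_rcons -!cats1 !run_gates_cat Ed Ed' /= -!cats1 -!catA; split=> //.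
congr (_ ++ (_ ++ [:: _])).
by case: g => [i j|i j|i] /=; rewrite !nth_rewire.
Qed.

Lemma net_outputs_lt z C : z < size ws + size C.1 ->
  all (fun k => k < size ws + size C.1) (net_outputs z U (size ws) C).
Proof.
move=> Hz; apply/allP => k /mapP[i _ ->] /=.
case: (ltnP i (size U + _)) => // lti.
rewrite /rewire; case: (ltnP i (size U)) => H; last by lia.
by apply: ltn_addr; exact: (allP HU _ (mem_nth 0 H)).
Qed.

Lemma run_insert z C : nth false ws z = false -> z < size ws ->
  exists d, [/\ run_gates ws (map (rewire_gate U (size ws)) C.1) = ws ++ d,
    size d = size C.1 &
    values (ws ++ d) (net_outputs z U (size ws) C) = eval_net C (values ws U)].
Proof.
move=> Hz ltz; have [d [Ed Ed' Sd]] := run_rewired C.1.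
exists d; split=> //; rewrite /values /net_outputs -map_comp /eval_net.
apply: eq_map => i /=; rewrite Ed; case: (ltnP i (size U + _)) => H; first by rewrite nth_rewire.
by rewrite nth_cat ltz Hz nth_default // size_cat size_map Sd.
Qed.

End Insert.

(** A selector of [V] or [U] by wire [b], placed from wire [W] on. The negation and three rows of
    [n] gates make [1 + 3 * n]; the last row, from [W + 1 + 2 * n], is the result. *)
Definition mux (b : nat) (U V : seq nat) (n W : nat) : seq gate :=
  Not b ::
  map (fun k => And b (nth 0 V k)) (iota 0 n) ++
  map (fun k => And W (nth 0 U k)) (iota 0 n) ++
  map (fun k => Or (W + 1 + k) (W + 1 + n + k)) (iota 0 n).

(* Gates that only read existing wires can be evaluated at once. *)
Definition old_gate (w : nat) (g : gate) : bool :=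
  match g with And i j | Or i j => (i < w) && (j < w) | Not i => i < w end.

Lemma run_old ws gs : all (old_gate (size ws)) gs ->
  run_gates ws gs = ws ++ map (gate_value ws) gs.
Proof.
elim/last_ind: gs => [|gs g IH]; first by rewrite cats0.
rewrite -cats1 all_cat run_gates_cat map_cat catA /= => /and3P[/IH -> Hg _].
rewrite cats1; congr rcons.
by case: g Hg => [i j /andP[Hi Hj]|i j /andP[Hi Hj]|i /= Hi] /=; [rewrite !nth_cat Hi Hj | rewrite !nth_cat Hi Hj | rewrite nth_cat Hi].
Qed.

Lemma run_mux ws b U V n : b < size ws -> size U = n -> size V = n ->
  all (fun k => k < size ws) U -> all (fun k => k < size ws) V ->
  exists d, [/\ run_gates ws (mux b U V n (size ws)) = ws ++ d, size d = 1 + 3 * n &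
    values (ws ++ d) (iota (size ws + 1 + 2 * n) n) =
    if nth false ws b then values ws V else values ws U].
Proof.
move=> ltb SU SV /allP HU /allP HV; set c := nth false ws b.
set W := size ws.
have lt_iota k : k \in iota 0 n -> k < n by rewrite mem_iota.
have ltU k : k < n -> nth 0 U k < W by move=> ltk; apply: HU; rewrite mem_nth ?SU.
have ltV k : k < n -> nth 0 V k < W by move=> ltk; apply: HV; rewrite mem_nth ?SV.
rewrite /mux -cat1s !run_gates_cat.
rewrite [run_gates ws _]run_old; last by rewrite /= ltb.
set w1 := ws ++ _; have S1 : size w1 = W + 1 by rewrite size_cat.
rewrite [run_gates w1 _]run_old; last first.
  rewrite all_map; apply/allP => k /lt_iota ltk /=.
  by rewrite S1 !ltn_addr ?ltV.
set w2 := w1 ++ _.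
have S2 : size w2 = W + 1 + n by rewrite size_cat S1 !size_map size_iota.
rewrite [run_gates w2 _]run_old; last first.
  rewrite all_map; apply/allP => k /lt_iota ltk /=.
  by rewrite S2; have := ltU _ ltk; lia.
set w3 := w2 ++ _.
have S3 : size w3 = W + 1 + n + n by rewrite size_cat S2 !size_map size_iota.
rewrite [run_gates w3 _]run_old; last first.
  by rewrite all_map; apply/allP => k /lt_iota ltk /=; rewrite S3; lia.
rewrite /w3 /w2 /w1 -!catA; eexists; split; first reflexivity.
  by rewrite !size_cat !size_map !size_iota /=; lia.
have Ec k : k < n -> nth false w3 (W + 1 + k) = c && nth false ws (nth 0 V k).
  move=> ltk; rewrite /w3 nth_cat S2 ltn_add2l ltk /w2 nth_cat S1 ltnNge leq_addr /=.
  rewrite addKn -map_comp (nth_map 0) ?size_iota // nth_iota //= /w1 !nth_cat.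
  by rewrite ltb ltV.
have Ec' k : k < n -> nth false w3 (W + 1 + n + k) = ~~ c && nth false ws (nth 0 U k).
  move=> ltk; rewrite /w3 nth_cat S2 ltnNge leq_addr /=.
  rewrite addKn -map_comp (nth_map 0) ?size_iota // nth_iota //= /w2 /w1 -catA !nth_cat.
  by rewrite ltnn subnn /= ltU.
apply: (@eq_from_nth _ false); rewrite ?size_map ?size_iota.
  by case: c {Ec Ec'}; rewrite size_map ?SU ?SV.
move=> k ltk; rewrite (nth_map 0) ?size_iota // nth_iota //.
have -> : W + 1 + 2 * n + k = size w3 + k by rewrite S3; lia.
rewrite !catA -/w1 -/w2 -/w3 nth_cat ltnNge leq_addr /= addKn.
rewrite -map_comp (nth_map 0) ?size_iota // nth_iota //= add0n Ec // Ec' //.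
by case: c {Ec Ec'} => /=; rewrite ?orbF (nth_map 0) ?SU ?SV.
Qed.

Section PathCircuit.
Variables (n : nat) (f g : net).

(** One step of a descent: [g] and [f] give the sibling, the selector chooses, and [g] goes down. *)
Definition block_size : nat := size g.1 + size f.1 + (1 + 3 * n) + size g.1.

(* [n.+1] inputs and the constant wire [n.+1] come first. *)
Definition block_start (i : nat) : nat := n.+2 + i * block_size.

(** No recursion: a block ends with [g] applied to its own selector wires, whose positions depend on
    the block number alone. So each block can be written independently of the previous ones. The
    initial node repeats the constant wire. *)
Definition node_outputs (i : nat) : seq nat :=
  if i is j.+1 then
    net_outputs n.+1
      (iota (block_start j + size g.1 + size f.1 + 1 + 2 * n) n)
      (block_start j + size g.1 + size f.1 + (1 + 3 * n)) g
  else nseq n n.+1.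

Definition block (i : nat) : seq gate :=
  let U := node_outputs i in
  let W := block_start i in
  let V := net_outputs n.+1 U W g in
  let V' := net_outputs n.+1 V (W + size g.1) f in
  let W' := W + size g.1 + size f.1 in
  map (rewire_gate U W) g.1 ++ map (rewire_gate V (W + size g.1)) f.1 ++
  mux i U V' n W' ++
  map (rewire_gate (iota (W' + 1 + 2 * n) n) (W' + (1 + 3 * n))) g.1.

(* The first gate reads the wire that it drives, which is still missing. *)
Definition path_gates (m : nat) : seq gate :=
  And n.+1 n.+1 :: flatten (map block (iota 0 m)).

Hypotheses (Hf : size f.2 = n) (Hg : size g.2 = n).

(** Block [i] is steered by wire [i], which is an input bit only for [i <= n]; hence the bound on
    [m]. The constant wire directly follows the inputs and serves all blocks. *)
Lemma run_path (x : bits) m : size x = n.+1 -> m <= n.+1 ->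
  exists d, [/\ run_gates x (path_gates m) = x ++ false :: d,
    size (x ++ false :: d) = block_start m,
    all (fun k => k < block_start m) (node_outputs m) &
    values (x ++ false :: d) (node_outputs m) =
    foldl (descend (eval_net f) (eval_net g)) (nseq n false) (take m x)].
Proof.
move=> Sx; elim: m => [|m IH] lem.
  have E : run_gates x (path_gates 0) = x ++ [:: false].
    by rewrite /path_gates /= nth_default ?Sx // cats1.
  exists [::]; rewrite take0 /block_start mul0n addn0 size_cat Sx addn1; split=> //.
    by rewrite all_nseq ltnSn orbT.
  by rewrite /values map_nseq nth_cat Sx ltnn subnn.
have [d [Ed Sd Hd Vd]] := IH (ltnW lem).
set ws := x ++ false :: d in Ed Sd Vd.
have ltz : n.+1 < size ws by rewrite Sd /block_start; lia.
have Hz : nth false ws n.+1 = false by rewrite nth_cat Sx ltnn subnn.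
have Eb : nth false ws m = nth false x m by rewrite nth_cat Sx lem.
have ltb : m < size ws by rewrite ltnW // (leq_ltn_trans _ ltz).
have SU : size (node_outputs m) = n.
  by case: (m) => [|j]; rewrite /= ?size_nseq // size_map.
pose U := node_outputs m.
pose V := net_outputs n.+1 U (size ws) g.
rewrite -Sd in Hd.
have [d1 [E1 S1 V1]] := run_insert Hd g Hz ltz.
have HV : all (fun k => k < size (ws ++ d1)) V.
  by rewrite size_cat S1; apply: net_outputs_lt => //; apply: ltn_addr.
have catz d' : nth false (ws ++ d') n.+1 = false /\ n.+1 < size (ws ++ d').
  by rewrite nth_cat ltz Hz size_cat ltn_addr.
have [Hz1 ltz1] := catz d1.
have [d2 [E2 S2 V2]] := run_insert HV f Hz1 ltz1.
pose V' := net_outputs n.+1 V (size (ws ++ d1)) f.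
have HV' : all (fun k => k < size ((ws ++ d1) ++ d2)) V'.
  by rewrite size_cat S2; apply: net_outputs_lt => //; apply: ltn_addr.
have HU : all (fun k => k < size ((ws ++ d1) ++ d2)) U.
  by apply: sub_all Hd => k; rewrite -catA size_cat; apply: ltn_addr.
have ltb2 : m < size ((ws ++ d1) ++ d2) by rewrite -catA size_cat ltn_addr.
have SV' : size V' = n by rewrite size_map.
have [d3 [E3 S3 V3]] := run_mux ltb2 SU SV' HU HV'.
have HM : all (fun k => k < size (((ws ++ d1) ++ d2) ++ d3))
    (iota (size ((ws ++ d1) ++ d2) + 1 + 2 * n) n).
  by apply/allP => k; rewrite mem_iota [size (_ ++ d3)]size_cat S3; lia.
have [Hz3 ltz3] := catz (d1 ++ d2 ++ d3); rewrite !catA in Hz3 ltz3.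
have [d4 [E4 S4 V4]] := run_insert HM g Hz3 ltz3.
have W1 : size (ws ++ d1) = block_start m + size g.1 by rewrite size_cat S1 Sd.
have W2 : size ((ws ++ d1) ++ d2) = block_start m + size g.1 + size f.1.
  by rewrite size_cat W1 S2.
have W3 : size (((ws ++ d1) ++ d2) ++ d3) =
    block_start m + size g.1 + size f.1 + (1 + 3 * n) by rewrite size_cat W2 S3.
have W4 : size ((((ws ++ d1) ++ d2) ++ d3) ++ d4) = block_start m.+1.
  by rewrite size_cat W3 S4 /block_start /block_size; lia.
have Eout : node_outputs m.+1 = net_outputs n.+1
    (iota (size ((ws ++ d1) ++ d2) + 1 + 2 * n) n) (size (((ws ++ d1) ++ d2) ++ d3)) g.
  by rewrite W2 W3.
have Ews : x ++ false :: d ++ d1 ++ d2 ++ d3 ++ d4 = (((ws ++ d1) ++ d2) ++ d3) ++ d4.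
  by rewrite /ws -!catA.
exists (d ++ d1 ++ d2 ++ d3 ++ d4); rewrite Ews W4; split=> //.
- have -> : path_gates m.+1 = path_gates m ++ block m.
    by rewrite /path_gates -[m.+1]addn1 iotaD map_cat flatten_cat /= add0n cats0.
  rewrite run_gates_cat Ed /block -Sd !run_gates_cat E1.
  by move: E2 E3 E4; rewrite W1 W2 W3 Sd /V' /V /U W1 Sd => -> -> ->.
- rewrite Eout -W4 [size (_ ++ d4)]size_cat S4.
  by apply: net_outputs_lt => //; apply: ltn_addr.
- rewrite Eout V4 V3 (take_nth false) ?Sx // -cats1 foldl_cat /= -Vd /descend.
  have -> : nth false ((ws ++ d1) ++ d2) m = nth false x m.
    by rewrite -catA nth_cat ltb Eb.
  case: (nth false x m); first by rewrite V2 V1.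
  by rewrite -catA values_cat.
Qed.

End PathCircuit.

(** * Input and output of machines *)

(* Unlike [Loop], stops at the bottom of stack [i]. *)
Definition drain (i : 'I_4) (P : bool -> cmd) : cmd :=
  Seq (Op (Push r3 true))
    (Loop r3 (Case i (Seq (P true) (Op (Push r3 true)))
                     (Seq (P false) (Op (Push r3 true))) (Op (Push r3 false)))).

(** [S] abstracts the layout of the stacks (source, accumulator, stack 3), so that one proof serves
    every source and destination. *)
Lemma drainP (i : 'I_4) (P : bool -> cmd) (S : bits -> bits -> bits -> store)
    (acc : bits -> bool -> bits) K :
  (forall w v D, top (S w v D) i = ohead w) ->
  (forall w v D, do_op (Pop i) (S w v D) = S (behead w) v D) ->
  (forall w v D, top (S w v D) r3 = ohead D) ->
  (forall w v D, do_op (Pop r3) (S w v D) = S w v (behead D)) ->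
  (forall w v D b, do_op (Push r3 b) (S w v D) = S w v (b :: D)) ->
  (forall w v D b, within (P b) (S w v D) (S w (acc v b) D) K) ->
  forall w v D,
  within (drain i P) (S w v D) (S [::] (foldl acc v w) D) (size w * (K + 3) + 5).
Proof.
move=> Htop Hpop Htop3 Hpop3 Hpush3 HP w v D.
have -> : size w * (K + 3) + 5 = 1 + (size w * (K + 3) + 4) by lia.
apply: within_seq (within_op _ _) _; rewrite Hpush3.
elim: w v => [|b w IH] v /=.
  apply: within_le; first apply: (within_loop (T1 := 2) (T2 := 1)).
  - by rewrite Htop3.
  - rewrite Hpop3; apply: within_case; rewrite Htop Hpop /=; exact: within_op.
  - rewrite Hpush3; apply: withinE (within_exit _ _) _; first by rewrite Htop3.
    by rewrite Hpop3.
  - by [].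
apply: within_le; first apply: (within_loop (T1 := (K + 1).+1) _ _ (IH _)).
- by rewrite Htop3.
- rewrite Hpop3; apply: within_case; rewrite Htop Hpop /=.
  have H : within (Seq (P b) (Op (Push r3 true))) (S w v D) (S w (acc v b) (true :: D)) (K + 1).
    by apply: within_seq (HP _ _ _ _) _; rewrite -Hpush3; apply: within_op.
  by case: (b) H.
- by lia.
Qed.

Definition push_code (b : bool) : cmd := push_seq (true :: enc b).

Lemma push_codeP b s B C D : within (push_code b)
  [:: enc s; B; C; D] [:: enc (b :: s); B; C; D] 6.
Proof. by apply: within_le (push_seqP _ _ _ _ _) _; case: b. Qed.

(** The inputs are reversed onto stacks 2 and 1 because a list is serialized from its end. Each
    [false] is an empty list, and the last [true] is the root of the pair. *)
Definition read_inputs : cmd :=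
  Seq (drain r1 (fun b => Op (Push r2 b)))
    (Seq (drain r0 (fun b => Op (Push r1 b)))
      (Seq (Op (Push r0 false)) (Seq (drain r2 push_code)
        (Seq (Op (Push r0 false)) (Seq (drain r1 push_code) (Op (Push r0 true))))))).

Lemma read_inputsP x y : within read_inputs [:: x; y; [::]; [::]]
  [:: enc (x, y); [::]; [::]; [::]] ((size x + size y) * 100 + 100).
Proof.
eapply within_le.
  apply: within_seq.
    apply: (@drainP r1 _ (fun w v D => [:: x; w; v; D]) (fun v b => b :: v) 1) => //.
    by move=> *; apply: within_op.
  rewrite foldl_cons_rev cats0; apply: within_seq.
    apply: (@drainP r0 _ (fun w v D => [:: w; v; rev y; D]) (fun v b => b :: v) 1) => //.
    by move=> *; apply: within_op.
  rewrite foldl_cons_rev cats0; apply: within_seq; first exact: within_op.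
  apply: within_seq.
    apply: (@drainP r2 _ (fun w v D => [:: enc v; rev x; w; D]) (fun v b => b :: v) 6
      _ _ _ _ _ _ (rev y) [::]) => //.
    by move=> *; apply: push_codeP.
  rewrite foldl_cons_rev cats0 revK; apply: within_seq; first exact: within_op.
  apply: within_seq.
    pose (S := fun w v D : bits => [:: enc v ++ enc y; w; [::]; D]).
    apply: (@drainP r1 _ S (fun v b => b :: v) 6 _ _ _ _ _ _ (rev x) [::]) => //.
    move=> w v D b; apply: (@within_le _ _ _ (size (true :: enc b) + 2)).
      by apply: withinE (push_seqP _ _ _ _ _) _; rewrite /S /enc /= -catA.
    by case: (b).
  rewrite foldl_cons_rev cats0 revK; exact: within_op.
by rewrite !size_rev; lia.
Qed.

(** The code of the bit [true] has three bits and that of [false] one, hence the two extra pops. *)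
Definition write_output : cmd :=
  Seq (Loop r0 (Case r0 (Seq (Op (Pop r0)) (Seq (Op (Pop r0)) (Op (Push r1 true))))
                        (Op (Push r1 false)) (Op (Push r1 false))))
    (drain r1 (fun b => Op (Push r0 b))).

Lemma write_outputP (y : bits) : within write_output [:: enc y; [::]; [::]; [::]]
  [:: y; [::]; [::]; [::]] (size y * 100 + 100).
Proof.
have H B : within (Loop r0 (Case r0 (Seq (Op (Pop r0)) (Seq (Op (Pop r0)) (Op (Push r1 true))))
    (Op (Push r1 false)) (Op (Push r1 false)))) [:: enc y; B; [::]; [::]]
    [:: [::]; rev y ++ B; [::]; [::]] (size y * 5 + 1).
  elim: y B => [|b s IH] B; first exact: within_exit.
  apply: within_le; first apply: (within_loop (T1 := 4) _ _ _) => //.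
  - rewrite /do_op /update /=; apply: within_case; case: b => /=.
      by do 2 (apply: (@within_seq _ _ _ _ _ 1); first exact: within_op); apply: within_op.
    by apply: within_le (within_op _ _) _.
  - rewrite rev_cons -cats1 -catA; case: b; exact: IH.
  - by rewrite /=; lia.
eapply within_le.
  apply: within_seq (H [::]) _.
  apply: withinE; first apply: (@drainP r1 _ (fun w v D => [:: v; w; [::]; D]) (fun v b => b :: v) 1) => //.
    by move=> *; apply: within_op.
  by rewrite foldl_cons_rev !cats0 revK.
by rewrite size_cat size_rev /=; lia.
Qed.

Lemma sz_bits (x : bits) : sz x <= 4 * size x + 1.
Proof. by elim: x => // b s IH; rewrite sz_cons; case: b; rewrite /sz /=; move: IH; rewrite /sz; lia. Qed.

Lemma PT_machine (F : bits -> bits -> bits) : PT (fun p : bits * bits => F p.1 p.2) ->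
  exists (M : machine) (p : {poly nat}), forall x y,
    computes_within M [:: x; y] (F x y) p.[size x + size y]%R.
Proof.
move=> [[c [T [HT Hc]]] HF].
have [k Hk] : PB (fun p : bits * bits =>
    (sz p * 100 + 100 + (T p + (sz (F p.1 p.2) * 100 + 100))).*2).
  apply: PB_le (PB_mul (PB_const 2) (g := fun p : bits * bits =>
    @sz _ (coded_prod (coded_seq coded_bool) (coded_seq coded_bool)) p * 100 + 100 +
    (T p + (@sz _ (coded_seq coded_bool) (F p.1 p.2) * 100 + 100))) _) _.
    by pb.
  by move=> p; rewrite mul2n.
exists (cmachine (Seq read_inputs (Seq c write_output))).
(* By [sz_bits], [sz (x, y)] is at most [4 * (size x + size y) + 3], and the base of [PB] adds 2. *)
exists ((polyC 4%N * 'X + polyC 5%N) ^+ k)%R => x y.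
have H : within (Seq read_inputs (Seq c write_output)) [:: x; y; [::]; [::]]
    [:: F x y; [::]; [::]; [::]]
    ((size x + size y) * 100 + 100 + (T (x, y) + (size (F x y) * 100 + 100))).
  apply: within_seq (read_inputsP x y) _.
  apply: within_seq (write_outputP _).
  by have := Hc (x, y) [::] [::] [::] [::]; rewrite !cats0.
case: H => n len H.
have := cmachine_computes H; apply.
have -> : ((polyC 4%N * 'X + polyC 5%N) ^+ k).[size x + size y]%R = (4 * (size x + size y) + 5) ^ k.
  by rewrite horner_exp hornerD hornerCM hornerX hornerC natrXE.
have le1 : (sz (x, y) + 2) ^ k <= (4 * (size x + size y) + 5) ^ k.
  case: (k) => // k'; rewrite leq_exp2r // sz_pair.
  by have := sz_bits x; have := sz_bits y; lia.
apply: leq_trans le1; apply: leq_trans (Hk (x, y)); rewrite leq_double.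
apply: leq_trans len _.
have := @size_sz _ coded_bool x; have := @size_sz _ coded_bool y.
have := @size_sz _ coded_bool (F x y); rewrite sz_pair /=; lia.
Qed.

Lemma PT_poly_time2 (F : bits -> bits -> bits) :
  PT (fun p : bits * bits => F p.1 p.2) -> poly_time2 F.
Proof. exact: PT_machine. Qed.

Lemma PT_poly_time1 (F : bits -> bits) : PT F -> poly_time1 F.
Proof.
move=> HF; have H : PT (fun p : bits * bits => F p.1) by pt.
have [M [p Hp]] := PT_machine (F := fun x _ => F x) H.
exists M, p => x; have := Hp x [::].
have -> : (size x + size (@nil bool))%R = size x by exact: addn0.
rewrite /computes_within.
(* A missing input and an empty one both leave the tape blank. *)
suff -> : initial M [:: x; [::]] = initial M [:: x] by [].
congr (_, _); apply/ffunP => i; rewrite !ffunE.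
by case: (i : nat) => [|[|j]] //=; rewrite !nth_nil.
Qed.

(** * Running times *)

Section GateCodes.
Variables (E : Type) (cE : coded E).

Definition gate_repr (g : gate) : nat * (nat * nat) :=
  match g with
  | And i j => (0, (i, j))
  | Or i j => (1, (i, j))
  | Not i => (2, (i, 0))
  end.

Lemma tree_of_gate_repr g : tree_of (gate_repr g) = tree_of g.
Proof. by case: g. Qed.

Lemma PT_and (i j : E -> nat) : PT i -> PT j -> PT (fun e => And (i e) (j e)).
Proof. by move=> Hi Hj; apply: PT_recode (PT_pair (PT_const 0) (PT_pair Hi Hj)) _. Qed.

Lemma PT_or (i j : E -> nat) : PT i -> PT j -> PT (fun e => Or (i e) (j e)).
Proof. by move=> Hi Hj; apply: PT_recode (PT_pair (PT_const 1) (PT_pair Hi Hj)) _. Qed.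

Lemma PT_not (i : E -> nat) : PT i -> PT (fun e => Not (i e)).
Proof. by move=> Hi; apply: PT_recode (PT_pair (PT_const 2) (PT_pair Hi (PT_const 0))) _. Qed.

Lemma PT_match_gate (A : Type) (cA : coded A) (g : E -> gate)
    (a b : E -> nat -> nat -> A) (c : E -> nat -> A) :
  PT g -> PT (fun p : E * nat * nat => a p.1.1 p.1.2 p.2) ->
  PT (fun p : E * nat * nat => b p.1.1 p.1.2 p.2) ->
  PT (fun p : E * nat => c p.1 p.2) ->
  PT (fun e => match g e with
               | And i j => a e i j | Or i j => b e i j | Not i => c e i end).
Proof.
move=> Hg Ha Hb Hc.
have Hr : PT (fun e => gate_repr (g e)).
  by apply: PT_recode Hg _ => e; rewrite tree_of_gate_repr.
pose r e := gate_repr (g e).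
apply: (PT_ext (f := fun e => if (r e).1 == 0 then a e (r e).2.1 (r e).2.2 else
  if (r e).1 == 1 then b e (r e).2.1 (r e).2.2 else c e (r e).2.1)).
  by rewrite /r; pt.
by move=> e; rewrite /r; case: (g e).
Qed.

End GateCodes.

Lemma PT_gate_value (E : Type) (cE : coded E) (ws : E -> bits) (g : E -> gate) :
  PT ws -> PT g -> PT (fun e => gate_value (ws e) (g e)).
Proof.
move=> Hws Hg.
apply: (PT_match_gate (a := fun e i j => nth false (ws e) i && nth false (ws e) j)
  (b := fun e i j => nth false (ws e) i || nth false (ws e) j)
  (c := fun e i => ~~ nth false (ws e) i) Hg); pt.
Qed.

Lemma PT_eval_net (E : Type) (cE : coded E) (C : E -> net) (x : E -> bits) :
  PT C -> PT x -> PT (fun e => eval_net (C e) (x e)).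
Proof.
move=> HC Hx.
pose W e := run_gates (x e) (C e).1.
have Hr : PT W.
  apply: (PT_foldl (f := fun _ ws g => rcons ws (gate_value ws g)) (B := fun _ _ => 4) _ Hx _ _ _).
  - by pt.
  - by pt; apply: PT_gate_value; pt.
  - by pb.
  - move=> e ws g; have := @sz_cat _ coded_bool ws [:: gate_value ws g].
    by rewrite cats1 sz_cons sz_nil; case: (gate_value _ _); rewrite /sz /=; lia.
rewrite -[fun e => _]/(fun e => map (nth false (W e)) (C e).2); pt.
Qed.

Lemma PT_parse_nat : PT parse_nat.
Proof.
have Hi : PT (fun x : bits => index false x).
  pose f (st : bool * nat) (b : bool) :=
    if st.1 then st else if b then (false, st.2.+1) else (true, st.2).
  have Ef x k : (foldl f (false, k) x).2 = k + index false x.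
    elim: x k => [|[] x IH] k /=; rewrite ?addn0 // ?IH ?addnS //.
    by elim: x {IH} => //= b x; rewrite {1}/f.
  apply: PT_ext (PT_snd (PT_foldl (f := fun _ => f) (B := fun _ _ => 4) PT_id (PT_const (false, 0)) _ _ _)) _.
  - by rewrite /f; pt.
  - by pb.
  - move=> _ [s k] b; rewrite /f /=; case: s; first by lia.
    by case: b; rewrite !sz_pair !sz_nat /sz /=; lia.
  - by move=> x; rewrite Ef.
by rewrite /parse_nat; pt.
Qed.

Lemma sz_parse_nat x q : parse_nat x = Some q -> sz q.1 + sz q.2 <= sz x.
Proof.
case: q => k r /parse_nat_sound ->.
have H : sz (code_nat k) = 4 * k + 3.
  elim: k => // k IH; rewrite /code_nat /= sz_cons -/(code_nat k) IH.
  by have -> : @sz _ coded_bool true = 3 by []; lia.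
by have := @sz_cat _ coded_bool (code_nat k) r; rewrite H sz_nat /=; lia.
Qed.

Ltac pt_extra ::=
  lazymatch goal with
  | |- PT (fun e => And _ _) => apply: PT_and
  | |- PT (fun e => Or _ _) => apply: PT_or
  | |- PT (fun e => Not _) => apply: PT_not
  | |- PT (fun e => eval_net _ _) => apply: PT_eval_net
  end.

Lemma PT_parse_gate : PT parse_gate.
Proof. by have H := PT_parse_nat; rewrite /parse_gate; pt. Qed.

Lemma sz_parse_gate x q : parse_gate x = Some q -> sz q.1 + sz q.2 <= sz x + 20.
Proof.
have szg g : sz g = sz (gate_repr g) by rewrite /sz /enc tree_of_gate_repr.
rewrite szg; case: x => [|b x] //=; rewrite sz_cons; have := @sz_gt0 _ _ b.
case: b.
  case: x => [|b x] //=; rewrite sz_cons; have := @sz_gt0 _ _ b.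
  case E: (parse_nat x) => [[i y]|] //=; case E': (parse_nat y) => [[j z]|] //=.
  have /= := sz_parse_nat E; have /= := sz_parse_nat E'.
  by move=> le1 le2 lt1 lt2 [<-] /=; case: b {lt1}; rewrite /= !sz_pair !sz_nat in le1 le2 *; lia.
case E: (parse_nat x) => [[i y]|] //=; have /= := sz_parse_nat E.
by move=> le1 lt1 [<-] /=; rewrite !sz_pair !sz_nat in le1 *; lia.
Qed.

(** The hypothesis on sizes says that parsing trades input for output up to a constant, which gives
    the additive growth that [PT_iter] demands. *)
Lemma PT_parse_seq (T : Type) (cT : coded T) (parse : bits -> option (T * bits)) :
  PT parse -> (forall x q, parse x = Some q -> sz q.1 + sz q.2 <= sz x + 20) ->
  PT (parse_seq parse).
Proof.
move=> Hp Hsz.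
have H : PT (fun x => parse_run parse x).
  apply: (PT_iter (f := fun _ => parse_step parse) (B := fun _ => 30)).
  - by pb.
  - move=> _ [[acc x] b]; rewrite /parse_step /=; case: b; last by lia.
    case: x => [|b x] /=; first by lia.
    case: b; last by rewrite !sz_pair !sz_cons /=; lia.
    case E: (parse x) => [[v r]|]; rewrite !sz_pair !sz_cons /=; last by rewrite sz_nil; lia.
    by have /= := Hsz _ _ E; lia.
  - by pt.
  - by pt.
  - by rewrite /parse_step; pt.
by rewrite /parse_seq; pt.
Qed.

Lemma PT_parse_instance : PT parse_instance.
Proof.
have H1 := PT_parse_nat.
have H2 := PT_parse_seq PT_parse_nat (fun x q E => leq_trans (sz_parse_nat E) (leq_addr 20 _)).
have H3 := PT_parse_seq PT_parse_gate sz_parse_gate.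
have H4 : PT parse_net by rewrite /parse_net; pt.
by rewrite /parse_instance; pt.
Qed.

Section Solve.
Variables (E : Type) (cE : coded E).

Lemma PT_rewire (U : E -> seq nat) (W i : E -> nat) :
  PT U -> PT W -> PT i -> PT (fun e => rewire (U e) (W e) (i e)).
Proof. by move=> *; rewrite /rewire; pt. Qed.

Lemma PT_is_nephew_solution (f g : E -> net) (u : E -> bits) : PT f -> PT g -> PT u ->
  PT (fun e => is_nephew_solution (eval_net (f e)) (eval_net (g e)) (u e)).
Proof. by move=> *; rewrite /is_nephew_solution; pt. Qed.

Lemma PT_descend (f g : E -> net) (u : E -> bits) (b : E -> bool) :
  PT f -> PT g -> PT u -> PT b ->
  PT (fun e => descend (eval_net (f e)) (eval_net (g e)) (u e) (b e)).
Proof. by move=> *; rewrite /descend; pt. Qed.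

End Solve.

(** The bound does not involve [x]: this is what keeps the nodes of a descent from growing. *)
Lemma sz_eval_net C x : sz (eval_net C x) <= 4 * sz C.2 + 1.
Proof.
apply: leq_trans (sz_bits _) _; rewrite size_map.
by have := @size_sz _ coded_nat C.2; lia.
Qed.

Lemma PT_search (E : Type) (cE : coded E) (f g : E -> net) (u r : E -> bits) :
  PT f -> PT g -> PT u -> PT r ->
  PT (fun e => search (eval_net (f e)) (eval_net (g e)) (u e) (r e)).
Proof.
move=> Hf Hg Hu Hr; rewrite /search; apply: PT_fst.
pose B (e : E) (b : bool) := 8 * @sz _ (coded_seq coded_nat) (f e).2 +
  8 * @sz _ (coded_seq coded_nat) (g e).2 + 20.
apply: (PT_foldl (f := fun e => search_step (eval_net (f e)) (eval_net (g e)))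
  (B := B) Hr (PT_pair (PT_const None) Hu) _ _ _).
- rewrite /search_step; pt; first [apply: PT_is_nephew_solution | apply: PT_descend]; pt.
- by rewrite /B; pb; pt.
- move=> e [w v] b; rewrite /search_step /B !sz_pair /= /descend.
  have H1 x := sz_eval_net (f e) x; have H2 x := sz_eval_net (g e) x.
  have := H2 (if b then eval_net (f e) (eval_net (g e) v) else v).
  move: (eval_net (g e) (if _ then _ else _)) => y.
  have H3 := H1 (eval_net (g e) v).
  case: w => [w|]; first by lia.
  case: is_nephew_solution; first by rewrite sz_some; lia.
  case: is_nephew_solution; first by rewrite sz_some; lia.
  by have := @sz_gt0 _ _ v; lia.
Qed.

(** * Membership in TFZPP and PWPP *)

Section PathCircuitTime.
Variables (E : Type) (cE : coded E).

Lemma PT_rewire_gates (U : E -> seq nat) (W : E -> nat) (s : E -> seq gate) :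
  PT U -> PT W -> PT s -> PT (fun e => map (rewire_gate (U e) (W e)) (s e)).
Proof.
move=> HU HW Hs; apply: (PT_map Hs).
by apply: (PT_match_gate (g := snd)); pt; apply: PT_rewire; pt.
Qed.

Lemma PT_net_outputs (z W : E -> nat) (U : E -> seq nat) (C : E -> net) :
  PT z -> PT U -> PT W -> PT C ->
  PT (fun e => net_outputs (z e) (U e) (W e) (C e)).
Proof. by move=> *; rewrite /net_outputs; pt; apply: PT_rewire; pt. Qed.

Lemma PT_mux (b n W : E -> nat) (U V : E -> seq nat) :
  PT b -> PT U -> PT V -> PT n -> PT W ->
  PT (fun e => mux (b e) (U e) (V e) (n e) (W e)).
Proof. by move=> *; rewrite /mux; pt. Qed.

Lemma PT_block_start (n i : E -> nat) (f g : E -> net) :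
  PT n -> PT f -> PT g -> PT i ->
  PT (fun e => block_start (n e) (f e) (g e) (i e)).
Proof. by move=> *; rewrite /block_start /block_size; pt. Qed.

End PathCircuitTime.

Ltac pt_extra ::=
  lazymatch goal with
  | |- PT (fun e => And _ _) => apply: PT_and
  | |- PT (fun e => Or _ _) => apply: PT_or
  | |- PT (fun e => Not _) => apply: PT_not
  | |- PT (fun e => eval_net _ _) => apply: PT_eval_net
  | |- PT (fun e => search _ _ _ _) => apply: PT_search
  | |- PT (fun e => is_nephew_solution _ _ _) => apply: PT_is_nephew_solution
  | |- PT (fun e => net_outputs _ _ _ _) => apply: PT_net_outputs
  | |- PT (fun e => mux _ _ _ _ _) => apply: PT_mux
  | |- PT (fun e => block_start _ _ _ _) => apply: PT_block_start
  end.

Lemma PT_node_outputs (E : Type) (cE : coded E) (n i : E -> nat) (f g : E -> net) :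
  PT n -> PT f -> PT g -> PT i ->
  PT (fun e => node_outputs (n e) (f e) (g e) (i e)).
Proof. by move=> *; rewrite /node_outputs; pt. Qed.

Lemma PT_block (E : Type) (cE : coded E) (n i : E -> nat) (f g : E -> net) :
  PT n -> PT f -> PT g -> PT i ->
  PT (fun e => block (n e) (f e) (g e) (i e)).
Proof.
move=> *; rewrite /block.
do 3 (apply: PT_cat; first by
  first [apply: PT_rewire_gates | apply: PT_mux]; pt; apply: PT_node_outputs; pt).
by apply: PT_rewire_gates; pt.
Qed.

Lemma PT_path_gates (E : Type) (cE : coded E) (n m : E -> nat) (f g : E -> net) :
  PT n -> PT f -> PT g -> PT m ->
  PT (fun e => path_gates (n e) (f e) (g e) (m e)).
Proof. by move=> *; rewrite /path_gates; pt; apply: PT_block; pt. Qed.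

Lemma PT_code_nat : PT code_nat.
Proof. by rewrite /code_nat; pt. Qed.

Lemma PT_code_gate : PT code_gate.
Proof.
have H := PT_code_nat; rewrite /code_gate.
by apply: (PT_match_gate (g := fun g => g)); pt.
Qed.

Lemma PT_code_seq (E T : Type) (cE : coded E) (cT : coded T) (c : T -> bits) (s : E -> seq T) :
  PT c -> PT s -> PT (fun e => code_seq c (s e)).
Proof. by move=> Hc Hs; rewrite /code_seq; pt. Qed.

Definition solve (x r : bits) : option bits :=
  if parse_instance x is Some p then
    search (eval_net p.2.1) (eval_net p.2.2) (nseq p.1 false) r
  else Some [::].

Lemma PT_solve : PT (fun p : bits * bits => solve p.1 p.2).
Proof. by have H := PT_parse_instance; rewrite /solve; pt. Qed.

Definition check_solution (x y : bits) : bool :=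
  if parse_instance x is Some p then
    (size y == p.1) && is_nephew_solution (eval_net p.2.1) (eval_net p.2.2) y
  else y == [::].

Lemma PT_check_solution : PT (fun p : bits * bits => check_solution p.1 p.2).
Proof. by have H := PT_parse_instance; rewrite /check_solution; pt. Qed.

Definition path_instance (x : bits) : bits :=
  if parse_instance x is Some p then
    code_nat p.1.+1 ++
    code_net (path_gates p.1 p.2.1 p.2.2 p.1.+1, node_outputs p.1 p.2.1 p.2.2 p.1.+1)
  else [::].

Lemma PT_path_instance : PT path_instance.
Proof.
have H := PT_parse_instance; have H1 := PT_code_nat; have H2 := PT_code_gate.
by rewrite /path_instance /code_net; pt; apply: PT_code_seq; pt;
  first [apply: PT_path_gates | apply: PT_node_outputs]; pt.
Qed.

Definition solution_of_collision (x y : bits) : bits :=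
  if parse_instance x is Some p then
    if solve x (take p.1.+1 y) is Some w then w else
    if solve x (drop p.1.+1 y) is Some w then w else [::]
  else [::].

Lemma PT_solution_of_collision :
  PT (fun p : bits * bits => solution_of_collision p.1 p.2).
Proof.
have H := PT_parse_instance; have H1 := PT_solve.
by rewrite /solution_of_collision; pt.
Qed.

(** * Correctness of the search and count of its failures *)

Lemma nephew_solutionE n (f g : circuit n n) (u : n.-tuple bool) :
  nephew_solution (eval f) (eval g) u <->
  is_nephew_solution (eval_net (net_of f)) (eval_net (net_of g)) u.
Proof.
have E (a b : n.-tuple bool) : (tval a == tval b) = (a == b) by [].
rewrite /nephew_solution /is_nephew_solution -!eval_netE !E.
split; first by case=> [/eqP ->|->]; rewrite ?eqxx ?orbT.
by case/orP => /eqP H; [left|right].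
Qed.

Lemma check_solutionP x y : Nephew x y <-> check_solution x y.
Proof.
rewrite /check_solution; case Ep: (parse_instance x) => [[n [F G]]|] /=.
  have [f [g [Ex EF EG]]] := parse_instance_sound Ep; split.
    case=> [[n' [f' [g' [u [Ex' -> Hu]]]]]|[[]]]; last by exists n, f, g.
    move: Ep; rewrite Ex' parse_instanceK => -[<- <- <-].
    by rewrite size_tuple eqxx; apply/nephew_solutionE.
  case/andP => Sy; rewrite EF EG => Hy; left.
  by exists n, f, g, (Tuple Sy); split=> //; apply/nephew_solutionE.
split=> [[[n [f [g [u [Ex _ _]]]]]|[_ ->]]|/eqP ->] //.
  by rewrite Ex parse_instanceK in Ep.
right; split=> // -[n [f [g Ex]]].
by rewrite Ex parse_instanceK in Ep.
Qed.

Lemma solve_sound x r y : solve x r = Some y -> Nephew x y.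
Proof.
rewrite /solve => H; apply/check_solutionP; rewrite /check_solution; move: H.
case Ep: (parse_instance x) => [[n [F G]]|] /=; last by case=> <-.
have [f [g [_ -> ->]]] := parse_instance_sound Ep.
have Hs (h : circuit n n) v : size (eval_net (net_of h) v) = n.
  by rewrite size_map size_tuple.
case/(search_sound (Hs f) (Hs g)) => [|-> ->]; first by rewrite size_nseq.
by rewrite eqxx.
Qed.

(** Ends of descents have [n] bits whatever the length [m], so the bound is the same for all [m];
    totality and the failure probability use it at different lengths. *)
Lemma card_unsolved x n F G m : parse_instance x = Some (n, (F, G)) ->
  #|[set r : m.-tuple bool | solve x r == None]| <= 2 ^ n.
Proof.
move=> Ep; have [f [g [_ EF EG]]] := parse_instance_sound Ep.
pose node (r : m.-tuple bool) := foldl (descend (eval_net F) (eval_net G)) (nseq n false) r.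
(* The default is never taken: [Sn] shows that every node has [n] bits. *)
pose h r : n.-tuple bool := insubd (nseq_tuple n false) (node r).
have Sn r : size (node r) == n.
  rewrite /node; elim: (tval r) (nseq n false) (size_nseq n false) => [|b s IH] u /= Su.
    by rewrite Su.
  by apply: IH; rewrite /descend size_map EG size_tuple.
have inj : {in [set r : m.-tuple bool | solve x r == None] &, injective h}.
  move=> r r'; rewrite !inE /solve Ep => /eqP /search_clear Hr /eqP /search_clear Hr'.
  move/(congr1 val); rewrite !val_insubd !Sn => Eh.
  by apply: val_inj; apply: (descend_inj Hr Hr') => //; rewrite !size_tuple.
rewrite -(card_in_imset inj); apply: leq_trans (max_card _) _.
by rewrite card_tuple card_bool.
Qed.

Lemma leq_size_instance x n F G : parse_instance x = Some (n, (F, G)) -> n <= size x.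
Proof.
case/parse_instance_sound => f [g [-> _ _]].
by rewrite /code_nephew size_cat size_rcons size_nseq; lia.
Qed.

(** Counting again: there are [2 ^ n.+1] strings of length [n.+1], too many for all of them to
    fail. *)
Lemma Nephew_total : total Nephew.
Proof.
move=> x; case Ep: (parse_instance x) => [[n [F G]]|]; last first.
  by exists [::]; apply: (@solve_sound x [::]); rewrite /solve Ep.
have : exists r : n.+1.-tuple bool, solve x r != None.
  apply/existsP; apply: contraTT (card_unsolved n.+1 Ep) => /existsPn H.
  have -> : [set r : n.+1.-tuple bool | solve x r == None] = setT.
    by apply/setP => r; rewrite !inE; apply/negPn/H.
  by rewrite cardsT card_tuple card_bool -ltnNge ltn_exp2l.
by case=> r; case E: (solve x r) => [y|] // _; exists y; apply: solve_sound E.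
Qed.

Lemma Nephew_TFNP : TFNP Nephew.
Proof.
split; last exact: Nephew_total; split.
  exists 'X%R => x y /check_solutionP; rewrite hornerX /check_solution.
  case Ep: (parse_instance x) => [[n [F G]]|] /=; last by move/eqP->.
  by case/andP => /eqP -> _; apply: leq_size_instance Ep.
exists check_solution; last exact: check_solutionP.
by apply: PT_poly_time2; have H := PT_check_solution; pt.
Qed.

(** The number of coins must be a polynomial in [size x]. As [n] is coded in unary, [n <= size x],
    so [size x + 2] coins leave at most a quarter of the strings, and more only help. *)
Lemma coin_prob_unsolved x m : size x + 2 <= m ->
  (coin_prob m (fun r => solve x r == None) <= 1 / 3%:R)%R.
Proof.
move=> lem; rewrite /coin_prob.
case Ep: (parse_instance x) => [[n [F G]]|]; last first.
  rewrite (_ : [set r : m.-tuple bool | _] = set0); last first.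
    by apply/setP => r; rewrite !inE /solve Ep.
  by rewrite cards0 GRing.mul0r.
have le1 := card_unsolved m Ep; set N := #|_| in le1 *.
have le2 : 4 * 2 ^ n <= 2 ^ m.
  by rewrite (_ : 4 = 2 ^ 2) // -expnD leq_exp2l //; have := leq_size_instance Ep; lia.
have le3 : 3 * N <= 2 ^ m by lia.
have lt0 : (0 < 2%:R ^+ m :> rat)%R by rewrite Num.Theory.exprn_gt0.
have le4 : (3%:R * N%:R <= 2%:R ^+ m :> rat)%R.
  by rewrite -GRing.natrM -GRing.natrX Num.Theory.ler_nat.
rewrite Num.Theory.ler_pdivrMr //; move: le4; set M := (_ ^+ m)%R; lra.
Qed.

Lemma Nephew_TFZPP : TFZPP Nephew.
Proof.
split; first exact: Nephew_TFNP.
exists solve, ('X + polyC 2%N)%R; split.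
  by apply: PT_poly_time2; have H := PT_solve; rewrite /code_answer; pt.
move=> x; split=> [r y|]; first exact: solve_sound.
by apply: coin_prob_unsolved; rewrite hornerD hornerX hornerC.
Qed.

(** * The reduction to Weak-Pigeon *)

Definition path_circuit n (f g : circuit n n) : circuit n.+1 n :=
  Circuit n.+1 (path_gates n (net_of f) (net_of g) n.+1)
    (insubd (nseq_tuple n 0) (node_outputs n (net_of f) (net_of g) n.+1)).

Lemma net_of_path_circuit n (f g : circuit n n) : net_of (path_circuit f g) =
  (path_gates n (net_of f) (net_of g) n.+1, node_outputs n (net_of f) (net_of g) n.+1).
Proof.
by rewrite /net_of /= val_insubd /net_outputs size_map size_tuple eqxx.
Qed.

Lemma eval_path_circuit n (f g : circuit n n) (a : n.+1.-tuple bool) :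
  tval (eval (path_circuit f g) a) =
  foldl (descend (eval_net (net_of f)) (eval_net (net_of g))) (nseq n false) a.
Proof.
rewrite eval_netE net_of_path_circuit.
have [d [Ed _ _ Vd]] := @run_path n (net_of f) (net_of g) (size_tuple _) (size_tuple _)
  a n.+1 (size_tuple a) (leqnn _).
rewrite -[eval_net _ _]/(values (run_gates _ (path_gates _ _ _ _)) _) Ed Vd.
by rewrite take_oversize ?size_tuple.
Qed.

(** A solution of [WeakPigeon] is a collision of some circuit with the given code, which has to be
    identified with the circuit of the descent. Comparing nets avoids equalities between dependent
    types. *)
Lemma code_weak_pigeon_inj n n' (h : circuit n.+1 n) (h' : circuit n'.+1 n') :
  code_weak_pigeon h = code_weak_pigeon h' -> n = n' /\ net_of h = net_of h'.
Proof.
move/(congr1 parse_nat); rewrite /code_weak_pigeon !parse_natK => -[En E]; split=> //.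
have := parse_netK (net_of h) [::]; have := parse_netK (net_of h') [::].
have {}E : code_net (net_of h) = code_net (net_of h') by [].
by rewrite !cats0 E => -> [Eg Eo]; rewrite /net_of Eg Eo.
Qed.

Lemma Nephew_reducible : reducible Nephew WeakPigeon.
Proof.
exists path_instance, solution_of_collision; split.
- exact: PT_poly_time1 PT_path_instance.
- exact: PT_poly_time2 PT_solution_of_collision.
move=> x y; rewrite /solution_of_collision.
case Ep: (parse_instance x) => [[n [F G]]|]; last first.
  (* On a malformed input the map back answers [[::]], its only solution, whatever [y] is. *)
  by move=> _; apply: (@solve_sound x [::]); rewrite /solve Ep.
have [f [g [_ EF EG]]] := parse_instance_sound Ep.
have -> : path_instance x = code_weak_pigeon (path_circuit f g).
  rewrite /path_instance Ep /code_weak_pigeon.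
  by rewrite -[code_circuit _]/(code_net (net_of _)) net_of_path_circuit -EF -EG.
case=> [[n' [h [a [b [Eh -> ab Eab]]]]]|[[]]]; last by exists n, (path_circuit f g).
have [En Enet] := code_weak_pigeon_inj Eh; subst n'.
rewrite take_size_cat ?size_tuple // drop_size_cat ?size_tuple //.
case Ea: (solve x a) => [w|]; first exact: solve_sound Ea.
case Eb: (solve x b) => [w|]; first exact: solve_sound Eb.
case: ab; apply: val_inj; move: Ea Eb; rewrite /solve Ep EF EG.
move=> /search_clear Ha /search_clear Hb; apply: (descend_inj Ha Hb).
  by rewrite !size_tuple.
by move/(congr1 (@tval n bool)): Eab; rewrite !eval_netE -Enet -!eval_netE !eval_path_circuit.
Qed.

Theorem theorem1p5 : TFZPP Nephew /\ PWPP Nephew.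
Proof.
split; first exact: Nephew_TFZPP.
by split; [exact: Nephew_TFNP | exact: Nephew_reducible].
Qed.
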